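(* Let $B$ be a body and let $P$ be the $G_{1B}$-structure on $B$, for $\alpha=0$ and $\beta,\gamma\neq 0$, given by a one-form $\omega$ without zeros, a one-dimensional distribution $L$ such that $\omega|_L=0$, and a volume form $\Omega$. Then $P$ is integrable if and only if $\omega$ is closed.
   Context: A body is a $3$-dimensional smooth manifold which can be covered with one chart. In this case ($\alpha=0$, $\beta=-\gamma\neq0$) $G_{1B}\subset GL(3,\mathbb{R})$ is the isotropy group of the covector $e^1$, the subspace $\langle e_3\rangle$ and the tensor $e^1\wedge e^2\wedge e^3$, where $(e_i)$ is the canonical basis of $\mathbb{R}^3$ and $(e^i)$ its dual basis. The corresponding $G_{1B}$-structure $P$ is the set of linear frames $(v_1,v_2,v_3)$ at points $x\in B$ such that $\omega(v_1)=1$, $\omega(v_2)=\omega(v_3)=0$, $v_3$ spans $L_x$, and $\Omega(v_1,v_2,v_3)=1$. A $G$-structure $P$ is integrable if around each point there are local coordinates $(x^1,x^2,x^3)$ whose coordinate frame is a section of $P$. *)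

(* Defs.v *)
From HB Require Import structures.
From mathcomp Require Import all_boot all_order all_algebra.
From mathcomp Require Import all_classical all_reals all_analysis.
From mathcomp Require Import ring.
Import Order.TTheory GRing.Theory Num.Theory.
Import numFieldNormedType.Exports.

Set Implicit Arguments.
Unset Strict Implicit.
Unset Printing Implicit Defensive.

Local Open Scope classical_set_scope.
Local Open Scope ring_scope.

Section smooth_maps.
Context {R : realType} {n : nat}.

(* [U] is meant to be open; for finite-dimensional [W] this is the usual C^k. *)
Fixpoint Ck_on {W : normedModType R} (k : nat) (U : set 'rV[R]_n)
    (f : 'rV[R]_n -> W) : Prop :=
  match k with
  | 0 => forall u, U u -> {for u, continuous f}
  | k'.+1 => (forall u, U u -> differentiable f u) /\
             (forall v, Ck_on k' U ('D_v f))
  end.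

Definition smooth_on {W : normedModType R} (U : set 'rV[R]_n)
    (f : 'rV[R]_n -> W) : Prop :=
  forall k, Ck_on k U f.

End smooth_maps.

(* A smooth 3-manifold whose smooth structure (and topology) is the one
   generated by a single global chart onto an open subset of R^3. *)
Record body (R : realType) := Body {
  body_pt :> Type;
  chart : body_pt -> 'rV[R]_3;
  chart_inj : injective chart;
  chart_open : open (range chart) }.
Arguments chart {R} b _.

Section bodies.
Context {R : realType} (B : body R).

Definition open_in (V : set B) : Prop := open (chart B @` V).

(* f o chart^-1; the value outside [range chart] is irrelevant. *)
Definition in_chart {T : pointedType} (f : B -> T) : 'rV[R]_3 -> T :=
  fun u => get [set t | exists2 x, chart B x = u & f x = t].

Definition body_smooth_on {W : normedModType R} (V : set B) (f : B -> W) :=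
  smooth_on (chart B @` V) (in_chart f).

(* Everywhere below, T_xB is identified with R^3 by means of the global chart. *)
Record one_form := OneForm {
  one_form_val :> forall x : B, {scalar 'rV[R]_3};
  one_form_smooth : forall v : 'rV[R]_3,
    body_smooth_on setT (fun x => one_form_val x v : R^o) }.

Definition without_zeros (w : one_form) : Prop := forall x, exists v, w x v != 0.

(* dw_x(u, v) = u(w(v)) - v(w(u)), where u and v are extended to vector fields
   with constant components in the chart, so that [u, v] = 0. *)
Definition ext_deriv (w : one_form) (x : B) (u v : 'rV[R]_3) : R :=
  'D_u (in_chart (fun y => w y v : R^o)) (chart B x) -
  'D_v (in_chart (fun y => w y u : R^o)) (chart B x).

Definition closed_form (w : one_form) : Prop :=
  forall x u v, ext_deriv w x u v = 0.

Record line_distribution := LineDistribution {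
  line :> forall x : B, {vspace 'rV[R]_3};
  line_dim : forall x, \dim (line x) = 1%N;
  line_smooth : forall p, exists (V : set B) (X : B -> 'rV[R]_3),
    [/\ open_in V, V p, body_smooth_on V X &
        forall x, V x -> line x = <[X x]>%VS] }.

Record three_form := ThreeForm {
  three_form_val :> forall x : B, 'rV[R]_3 -> 'rV[R]_3 -> 'rV[R]_3 -> R;
  three_form_linear1 : forall x v2 v3, scalar (fun v => three_form_val x v v2 v3);
  three_form_linear2 : forall x v1 v3, scalar (fun v => three_form_val x v1 v v3);
  three_form_linear3 : forall x v1 v2, scalar (fun v => three_form_val x v1 v2 v);
  three_form_alt12 : forall x v w, three_form_val x v v w = 0;
  three_form_alt13 : forall x v w, three_form_val x v w v = 0;
  three_form_alt23 : forall x v w, three_form_val x w v v = 0;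
  three_form_smooth : forall v1 v2 v3,
    body_smooth_on setT (fun x => three_form_val x v1 v2 v3 : R^o) }.

Definition is_volume_form (Om : three_form) : Prop :=
  forall x, exists v1 v2 v3, Om x v1 v2 v3 != 0.

(* Following the MathComp convention, A in GL(3, R) is the automorphism
   z |-> z *m A of R^3, and the frame (v_1, v_2, v_3), i.e. the isomorphism
   z |-> z_1 v_1 + z_2 v_2 + z_3 v_3, is the matrix F with rows v_i. The right
   action F.A = F o A of GL(3, R) on frames is therefore A *m F. *)
Record g_structure (G : set 'M[R]_3) := GStructure {
  frames :> forall x : B, set 'M[R]_3;
  frames_unit : forall x F, frames x F -> F \in unitmx;
  frames_act : forall x F A, frames x F -> G A -> frames x (A *m F);
  frames_trans : forall x F F', frames x F -> frames x F' ->
    exists2 A, G A & F' = A *m F;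
  frames_section : forall p, exists (V : set B) (s : B -> 'M[R]_3),
    [/\ open_in V, V p, body_smooth_on V s & forall x, V x -> frames x (s x)] }.

Record local_coordinates := LocalCoordinates {
  coord_dom : set B;
  coord_cod : set 'rV[R]_3;
  coord : B -> 'rV[R]_3;
  coord_inv : 'rV[R]_3 -> B;
  coord_dom_open : open_in coord_dom;
  coord_cod_open : open coord_cod;
  coord_in : forall x, coord_dom x -> coord_cod (coord x);
  coord_inv_in : forall u, coord_cod u -> coord_dom (coord_inv u);
  coordK : forall x, coord_dom x -> coord_inv (coord x) = x;
  coord_invK : forall u, coord_cod u -> coord (coord_inv u) = u;
  coord_smooth : body_smooth_on coord_dom coord;
  coord_inv_smooth : smooth_on coord_cod (chart B \o coord_inv) }.

(* The i-th row of the Jacobian of coord^-1 is d/dx^i. *)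
Definition coord_frame (c : local_coordinates) (x : B) : 'M[R]_3 :=
  jacobian (chart B \o coord_inv c) (coord c x).

Definition integrable_structure (G : set 'M[R]_3) (P : g_structure G) : Prop :=
  forall p, exists2 c : local_coordinates, coord_dom c p &
    forall x, coord_dom c x -> P x (coord_frame c x).

End bodies.

Section G1B.
Context {R : realType}.

(* e^1(z) = z_1 is the entry z 0 0 of the row vector z, and e^1/\e^2/\e^3 is
   the determinant of the matrix whose rows are the three arguments. *)
Definition e3 : 'rV[R]_3 := delta_mx 0 ord_max.

Definition G1B : set 'M[R]_3 := [set A |
  [/\ A \in unitmx,
      forall z : 'rV[R]_3, (z *m A) 0 0 = z 0 0,
      (<[e3 *m A]> = <[e3]>)%VS &
      forall Z : 'M[R]_3, \det (Z *m A) = \det Z]].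

Definition G1B_frames (B : body R) (w : one_form B) (L : line_distribution B)
    (Om : three_form B) (x : B) : set 'M[R]_3 := [set F |
  let v1 := row 0 F in let v2 := row 1 F in let v3 := row ord_max F in
  [/\ F \in unitmx,
      w x v1 = 1, w x v2 = 0 /\ w x v3 = 0,
      (<[v3]> = L x)%VS & Om x v1 v2 v3 = 1]].

End G1B.

Section smooth_calculus.
Context {R : realType} {n : nat}.
Implicit Types U : set 'rV[R]_n.

Lemma near_eq_differentiable (W : normedModType R) (f g : 'rV[R]_n -> W) a :
  (\near a, f a = g a) -> differentiable f a -> differentiable g a.
Proof.
move=> fg df.
have -> : g = f + (g - f) by rewrite addrC subrK.
apply: differentiableD => //.
have H : (g - f) \o shift a = cst ((g - f) a) + (\0 : {linear _ -> _}) +o_ 0 id.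
  apply/eqaddoP => e e0.
  have : \forall y \near 0, f (y + a) = g (y + a).
    by move: fg; rewrite (near_shift 0 a) subr0.
  move=> near0; near=> y.
  rewrite /=  !fctE /= (near near0 y)// (nbhs_singleton fg) !subrr !addr0 subr0 normr0.
  by rewrite mulr_ge0// ltW.
have D : 'd (g - f) a = \0 :> (_ -> _).
  by apply: diff_unique => //; exact: cst_continuous.
by apply/diff_locallyP; rewrite D; split => //; exact: cst_continuous.
Unshelve. all: by end_near. Qed.

Lemma near_open U (P : 'rV[R]_n -> Prop) u :
  open U -> U u -> (forall v, U v -> P v) -> \near u, P u.
Proof. by move=> oU Uu UP; apply: filterS UP _; exact: open_nbhs_nbhs. Qed.

Lemma Ck_ext k U (W : normedModType R) (f g : 'rV[R]_n -> W) :
  open U -> (forall u, U u -> f u = g u) -> Ck_on k U f -> Ck_on k U g.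
Proof.
move=> oU; elim: k f g => [|k IH] f g fg /=.
  move=> cf u Uu; have := cf _ Uu; rewrite /prop_for /continuous_at -fg//.
  have fgu : \near u, f u = g u by apply: (@near_open U (fun z => f z = g z)).
  by apply: cvg_trans; exact: (near_eq_cvg fgu).
move=> [df cf]; split => [u Uu|v].
  by apply: near_eq_differentiable (df _ Uu); apply: (@near_open U (fun z => f z = g z)).
by apply: IH (cf v) => u Uu; apply: near_eq_derive; apply: (@near_open U (fun z => f z = g z)).
Qed.

Lemma Ck_subset k U U' (W : normedModType R) (f : 'rV[R]_n -> W) :
  U' `<=` U -> Ck_on k U f -> Ck_on k U' f.
Proof.
move=> UU'; elim: k f => [|k IH] f /=; first by move=> cf u /UU' /cf.
by move=> [df cf]; split => [u /UU' /df|v]//; exact: IH.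
Qed.

Lemma Ck_pred k U (W : normedModType R) (f : 'rV[R]_n -> W) :
  Ck_on k.+1 U f -> Ck_on k U f.
Proof.
elim: k f => [|k IH] f; first by move=> [df _] u /df /differentiable_continuous.
by move=> [df cf]; split => // v; exact: IH.
Qed.

Lemma Ck_cst k U (W : normedModType R) (c : W) : Ck_on k U (fun=> c).
Proof.
elim: k c => [|k IH] c; first by move=> u _; exact: cst_continuous.
split => [u _|v]; first exact: differentiable_cst.
by have -> : 'D_v (fun=> c) = fun=> 0; [apply/funext => u; exact: derive_cst|].
Qed.

Lemma CkD k U (f g : 'rV[R]_n -> R^o) : open U ->
  Ck_on k U f -> Ck_on k U g -> Ck_on k U (f \+ g).
Proof.
move=> oU; elim: k f g => [|k IH] f g.
  move=> cf cg u Uu; have := @cvgD _ _ _ (nbhs u) _ f g _ _ (cf u Uu) (cg u Uu).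
  exact.
move=> [df cf] [dg cg]; split => [u Uu|v].
  by apply: differentiableD; [exact: df|exact: dg].
apply: (@Ck_ext _ _ _ ('D_v f \+ 'D_v g)) => // [u Uu|]; last exact: IH (cf v) (cg v).
rewrite (_ : f \+ g = f + g)// deriveD//.
  by apply: diff_derivable; exact: df.
by apply: diff_derivable; exact: dg.
Qed.

Lemma CkM k U (f g : 'rV[R]_n -> R^o) : open U ->
  Ck_on k U f -> Ck_on k U g -> Ck_on k U (f \* g).
Proof.
move=> oU; elim: k f g => [|k IH] f g.
  by move=> cf cg u Uu; exact: (@cvgM _ _ (nbhs u) _ f g _ _ (cf u Uu) (cg u Uu)).
move=> cf' cg'; have [df cf] := cf'; have [dg cg] := cg'; split => [u Uu|v].
  by apply: differentiableM; [exact: df|exact: dg].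
apply: (@Ck_ext _ _ _ ((f \* 'D_v g) \+ (g \* 'D_v f))) => // [u Uu|].
  rewrite (_ : f \* g = f * g)// deriveM//.
    by apply: diff_derivable; exact: df.
  by apply: diff_derivable; exact: dg.
apply: CkD => //.
  exact: IH (Ck_pred cf') (cg v).
exact: IH (Ck_pred cg') (cf v).
Qed.

Lemma CkV k U (f : 'rV[R]_n -> R^o) : open U -> (forall u, U u -> f u != 0) ->
  Ck_on k U f -> Ck_on k U (fun u => (f u)^-1).
Proof.
move=> oU f0; elim: k => [|k IH].
  by move=> cf u Uu; exact: (@cvgV _ _ (nbhs u) _ f _ (f0 u Uu) (cf u Uu)).
move=> cf'; have [df cf] := cf'; split => [u Uu|v].
  by apply: differentiableV; [exact: df|exact: f0].
apply: (@Ck_ext _ _ _ ((fun=> -1) \*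
    ((fun u => (f u)^-1) \* (fun u => (f u)^-1) \* 'D_v f))) => // [u Uu|].
  rewrite deriveV//; [|exact: f0|by apply: diff_derivable; exact: df].
  by rewrite /= mulN1r /GRing.scale /= mulNr expr2 invfM.
have fV := IH (Ck_pred cf').
have D := CkM oU (CkM oU fV fV) (cf v).
exact: CkM oU (Ck_cst _ _ _) D.
Qed.

Lemma Ck_mx k U p q (f : 'rV[R]_n -> 'M[R]_(p, q)) : open U ->
  Ck_on k U f <-> (forall i j, Ck_on k U (fun u => f u i j : R^o)).
Proof.
move=> oU; elim: k f => [|k IH] f.
  split=> [cf i j u Uu|cf u Uu].
    exact: (@continuous_comp _ _ _ f (fun M : 'M[R]_(p, q) => M i j : R^o) u
      (cf u Uu) (@coord_continuous _ _ _ i j (f u))).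
  have -> : f = \sum_i \sum_j (fun u => f u i j *: delta_mx i j).
    apply/funext => z; rewrite fct_sumE [LHS]matrix_sum_delta.
    by apply: eq_bigr => i _; rewrite fct_sumE.
  apply: (big_ind (fun h : 'rV[R]_n -> 'M[R]_(p, q) => {for u, continuous h})).
  - exact: cst_continuous.
  - by move=> *; exact: continuousD.
  move=> i _.
  apply: (big_ind (fun h : 'rV[R]_n -> 'M[R]_(p, q) => {for u, continuous h})).
  - exact: cst_continuous.
  - by move=> *; exact: continuousD.
  move=> j _; exact: (@cvgZr_tmp _ _ _ (nbhs u) _ (fun z => f z i j) _
    (delta_mx i j) (cf i j u Uu)).
split=> [[df cf] i j|cf].
  split=> [u Uu|v].
    exact: (@differentiable_comp _ _ _ R^o f (fun M : 'M[R]_(p, q) => M i j : R^o)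
      u (df u Uu) (@differentiable_coord _ _ _ (f u) i j)).
  apply: Ck_ext (((IH _).1 (cf v)) i j) => // u Uu.
  by rewrite derive_mx ?mxE//; apply: diff_derivable; exact: df.
have df u : U u -> differentiable f u.
  move=> Uu.
  have -> : f = \sum_i \sum_j (fun u => f u i j *: delta_mx i j).
    apply/funext => z; rewrite fct_sumE [LHS]matrix_sum_delta.
    by apply: eq_bigr => i _; rewrite fct_sumE.
  apply: differentiable_sum => i; apply: differentiable_sum => j.
  by apply: differentiableZl; have [+ _] := cf i j; exact.
split=> // v; apply/IH => i j; have [_ /(_ v)] := cf i j.
apply: Ck_ext => // u Uu; rewrite derive_mx ?mxE//.
by apply: diff_derivable; exact: df.
Qed.

End smooth_calculus.

Section body_calculus.
Context {R : realType} (B : body R).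
Implicit Types V : set B.

Lemma in_chartE (T : pointedType) (f : B -> T) x : in_chart f (chart B x) = f x.
Proof.
rewrite /in_chart; apply: (@get_unique _ _ (f x)); first by exists x.
by move=> t [y /(@chart_inj _ B) -> ->].
Qed.

Lemma body_smooth_subset V V' (W : normedModType R) (f : B -> W) :
  V' `<=` V -> body_smooth_on V f -> body_smooth_on V' f.
Proof. by move=> VV' sf k; apply: Ck_subset (sf k); exact: image_subset. Qed.

Lemma body_smooth_cst V (W : normedModType R) (c : W) : open_in V ->
  body_smooth_on V (fun=> c).
Proof.
move=> oV k; apply: (@Ck_ext _ _ _ _ _ (fun=> c)) => //; last exact: Ck_cst.
by move=> _ [x _ <-]; rewrite in_chartE.
Qed.

Lemma body_smoothD V (f g : B -> R^o) : open_in V ->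
  body_smooth_on V f -> body_smooth_on V g -> body_smooth_on V (f \+ g).
Proof.
move=> oV sf sg k; apply: (Ck_ext oV) (CkD oV (sf k) (sg k)).
by move=> _ [x _ <-]; rewrite /= !in_chartE.
Qed.

Lemma body_smoothM V (f g : B -> R^o) : open_in V ->
  body_smooth_on V f -> body_smooth_on V g -> body_smooth_on V (f \* g).
Proof.
move=> oV sf sg k; apply: (Ck_ext oV) (CkM oV (sf k) (sg k)).
by move=> _ [x _ <-]; rewrite /= !in_chartE.
Qed.

Lemma body_smoothV V (f : B -> R^o) : open_in V -> (forall x, V x -> f x != 0) ->
  body_smooth_on V f -> body_smooth_on V (fun x => (f x)^-1).
Proof.
move=> oV f0 sf k; apply: (Ck_ext oV) (CkV oV _ (sf k)).
  by move=> _ [x _ <-]; rewrite /= !in_chartE.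
by move=> _ [x Vx <-]; rewrite in_chartE f0.
Qed.

Lemma body_smooth_sum3 V (f : 'I_3 -> B -> R^o) : open_in V ->
  (forall i, body_smooth_on V (f i)) ->
  body_smooth_on V (fun x => \sum_i f i x : R^o).
Proof.
move=> oV sf.
have -> : (fun x => \sum_i f i x : R^o) =
    f ord0 \+ (f (lift ord0 ord0) \+ f (lift ord0 (lift ord0 ord0))).
  by apply/funext => x; rewrite !big_ord_recl big_ord0 addr0.
by apply: body_smoothD => //; exact: body_smoothD.
Qed.

Lemma body_smooth_mx V p q (f : B -> 'M[R]_(p, q)) : open_in V ->
  body_smooth_on V f <-> (forall i j, body_smooth_on V (fun x => f x i j : R^o)).
Proof.
move=> oV; have E i j u : (chart B @` V) u ->
    in_chart f u i j = in_chart (fun x => f x i j : R^o) u.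
  by move=> [x _ <-]; rewrite !in_chartE.
split=> [sf i j k|sf k].
  apply: (Ck_ext oV (E i j)); exact: ((Ck_mx _ _ oV).1 (sf k)).
apply/(Ck_mx _ _ oV) => i j.
by apply: (Ck_ext oV) (sf i j k) => u Vu; rewrite E.
Qed.

Lemma open_in_neq0 V (f : B -> R^o) : open_in V -> body_smooth_on V f ->
  open_in (V `&` [set x | f x != 0]).
Proof.
move=> oV sf; rewrite /open_in openE => _ [x [Vx fx0] <-].
have Vc : (chart B @` V) (chart B x) by exists x.
have cf := sf 0%N _ Vc.
have n0 : \forall u \near chart B x, in_chart f u != 0.
  by apply: (cvgr_neq0 _ cf); rewrite in_chartE.
have nV : nbhs (chart B x) (chart B @` V) by exact: open_nbhs_nbhs.
apply: filterS (filterI nV n0) => _ [[y Vy <-]]; rewrite in_chartE => fy0.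
by exists y.
Qed.

Lemma scalar_expand (f : 'rV[R]_3 -> R) (v : 'rV[R]_3) : scalar f ->
  f v = \sum_i v 0 i * f (delta_mx 0 i).
Proof.
move=> lf.
have f0 : f 0 = 0.
  have := lf (-1) 0 0; rewrite scaler0 addr0 => {1}->.
  by rewrite /= mulN1r addNr.
rewrite {1}[v]row_sum_delta !big_ord_recl !big_ord0 !lf f0.
by [].
Qed.

Lemma body_smooth_scalar V (f : B -> 'rV[R]_3 -> R) (X : B -> 'rV[R]_3) :
  open_in V -> (forall x, scalar (f x)) ->
  (forall v, body_smooth_on V (fun x => f x v : R^o)) -> body_smooth_on V X ->
  body_smooth_on V (fun x => f x (X x) : R^o).
Proof.
move=> oV lf sf sX.
have -> : (fun x => f x (X x) : R^o) =
    (fun x => \sum_i (X x 0 i * f x (delta_mx 0 i))).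
  by apply/funext => x; exact: scalar_expand.
apply: body_smooth_sum3 => // i; apply: body_smoothM => //.
by have /(body_smooth_mx _ oV) := sX; exact.
Qed.

Lemma three_form_det (Om : three_form B) x (M : 'M[R]_3) :
  let e i : 'rV[R]_3 := delta_mx 0 i in
  Om x (row ord0 M) (row 1 M) (row ord_max M) =
  \det M * Om x (e ord0) (e 1) (e ord_max).
Proof.
move=> e.
have l1 u v w := scalar_expand u (@three_form_linear1 _ _ Om x v w).
have l2 u v w := scalar_expand v (@three_form_linear2 _ _ Om x u w).
have l3 u v w := scalar_expand w (@three_form_linear3 _ _ Om x u v).
have a12 := @three_form_alt12 _ _ Om x.
have a13 := @three_form_alt13 _ _ Om x.
have a23 := @three_form_alt23 _ _ Om x.
have s12 u v w : Om x v u w = - Om x u v w.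
  have := a12 (1 *: u + v) w.
  rewrite three_form_linear1 !three_form_linear2 !a12 /= !mul1r addr0 add0r.
  by move/eqP; rewrite addrC addr_eq0 => /eqP.
have s23 u v w : Om x u w v = - Om x u v w.
  have := a23 (1 *: v + w) u.
  rewrite three_form_linear2 !three_form_linear3 !a23 /= !mul1r addr0 add0r.
  by move/eqP; rewrite addrC addr_eq0 => /eqP.
have E0 : ord0 = 0 :> 'I_3 by [].
have E1 : lift ord0 ord0 = 1 :> 'I_3 by exact/val_inj.
have E2 : lift ord0 (lift ord0 ord0) = ord_max :> 'I_3 by exact/val_inj.
rewrite l1 !big_ord_recl big_ord0 E2 E1 !mxE.
rewrite !(l2 _ (row 1 M)) !big_ord_recl !big_ord0 E2 E1 !mxE !a12.
rewrite !(l3 _ _ (row ord_max M)) !big_ord_recl !big_ord0 E2 E1 !mxE !a13 !a23 -!/(e _).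
rewrite (s12 (e ord0) (e 1)) (s23 (e ord0) (e 1) (e ord_max)).
rewrite (s12 (e ord0) (e ord_max) (e 1)) (s23 (e ord0) (e 1) (e ord_max)).
rewrite (s23 (e 1) (e ord0)) (s12 (e ord0) (e 1)).
rewrite (s12 (e 1) (e ord_max)) (s23 (e 1) (e ord0)) (s12 (e ord0) (e 1)).
rewrite (expand_det_row _ ord0) !big_ord_recl big_ord0 /cofactor.
rewrite !(expand_det_row _ ord0) !big_ord_recl !big_ord0 /cofactor !det_mx11 !mxE.
have [m mE] : exists m : nat -> nat -> R, forall i j : 'I_3, M i j = m i j.
  by exists (fun i j => M (inord i) (inord j)) => i j; rewrite !inord_val.
rewrite !mE /= /bump /=; ring.
Qed.

Lemma frame_one_form (w : one_form B) x (F : 'M[R]_3) :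
  w x (row 0 F) = 1 -> w x (row 1 F) = 0 -> w x (row ord_max F) = 0 ->
  forall z : 'rV[R]_3, w x (z *m F) = z 0 0.
Proof.
move=> w0 w1 w2 z; rewrite mulmx_sum_row linear_sum /= !big_ord_recl big_ord0.
rewrite (_ : lift ord0 ord0 = 1); last exact/val_inj.
rewrite (_ : lift ord0 (lift ord0 ord0) = ord_max); last exact/val_inj.
by rewrite !linearZ /= w0 w1 w2 !mulr0 mulr1 !addr0.
Qed.

Lemma G1B_frames_unit (w : one_form B) (L : line_distribution B)
    (Om : three_form B) x F : G1B_frames w L Om x F -> F \in unitmx.
Proof. by case. Qed.

Lemma e3_mul (F : 'M[R]_3) : e3 *m F = row ord_max F.
Proof. by rewrite rowE. Qed.

Lemma vline_mulmx (u v : 'rV[R]_3) (A : 'M[R]_3) :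
  (<[u]> = <[v]>)%VS -> (<[u *m A]> = <[v *m A]>)%VS.
Proof.
move=> uv; apply/eqP; rewrite eqEsubv -!memvE; apply/andP; split.
  have : u \in <[v]>%VS by rewrite -uv memv_line.
  by move=> /vlineP[k ->]; rewrite -scalemxAl memvZ// memv_line.
have : v \in <[u]>%VS by rewrite uv memv_line.
by move=> /vlineP[k ->]; rewrite -scalemxAl memvZ// memv_line.
Qed.

Lemma G1B_frames_act (w : one_form B) (L : line_distribution B)
    (Om : three_form B) x F A :
  G1B_frames w L Om x F -> G1B A -> G1B_frames w L Om x (A *m F).
Proof.
move=> [Fu w1 [w2 w3] v3L Om1] [Au A1 A3 Ad].
have wE := frame_one_form w1 w2 w3.
split.
- by rewrite unitmx_mul Au.
- by rewrite row_mul wE rowE A1 mxE.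
- by rewrite !row_mul !wE !rowE !A1 !mxE.
- by rewrite row_mul -v3L -!e3_mul; apply: vline_mulmx.
rewrite three_form_det det_mulmx -mulrA -three_form_det Om1 mulr1.
by rewrite -[A]mul1mx Ad det1.
Qed.

Lemma G1B_frames_trans (w : one_form B) (L : line_distribution B)
    (Om : three_form B) x F F' :
  G1B_frames w L Om x F -> G1B_frames w L Om x F' ->
  exists2 A, G1B A & F' = A *m F.
Proof.
move=> [Fu w1 [w2 w3] v3L Om1] [Fu' w1' [w2' w3'] v3L' Om1'].
have wE := frame_one_form w1 w2 w3; have wE' := frame_one_form w1' w2' w3'.
exists (F' *m invmx F); last by rewrite mulmxKV.
have Fn0 : Om x (delta_mx 0 ord0) (delta_mx 0 1) (delta_mx 0 ord_max) != 0.
  apply/eqP => O0; move: Om1; rewrite three_form_det O0 mulr0 => /esym/eqP.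
  by rewrite oner_eq0.
have dE : \det F' = \det F.
  by apply: (mulIf Fn0); rewrite -!three_form_det Om1.
split.
- by rewrite unitmx_mul Fu' unitmx_inv.
- by move=> z; rewrite -[LHS]wE -mulmxA mulmxKV// wE'.
- rewrite mulmxA -{2}[e3](mulmxK Fu); apply: vline_mulmx.
  by rewrite !e3_mul v3L.
move=> Z; rewrite !det_mulmx dE -det_mulmx mulmxV ?det1 ?mulr1//.
Qed.

Lemma form_smooth_restr (w : one_form B) (V : set B) v :
  body_smooth_on V (fun x => w x v : R^o).
Proof. exact: (@body_smooth_subset setT V _ _ _ (one_form_smooth w v)). Qed.

Lemma G1B_frames_section (w : one_form B) (L : line_distribution B)
    (Om : three_form B) :
  without_zeros w -> (forall x v, v \in L x -> w x v = 0) ->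
  is_volume_form Om ->
  forall p, exists (V : set B) (s : B -> 'M[R]_3),
    [/\ open_in V, V p, body_smooth_on V s &
        forall x, V x -> G1B_frames w L Om x (s x)].
Proof.
move=> w0 wL Om0 p.
have [V0 [X [oV0 V0p sX LX]]] := line_smooth L p.
have wX x : V0 x -> w x (X x) = 0.
  by move=> V0x; apply: wL; rewrite LX// memv_line.
have [u wu] := w0 p.
pose c : 'rV[R]_3 := \row_j
  if j == 0 then X p 0 1 * u 0 ord_max - X p 0 ord_max * u 0 1
  else if j == 1 then X p 0 ord_max * u 0 0 - X p 0 0 * u 0 ord_max
  else X p 0 0 * u 0 1 - X p 0 1 * u 0 0.
have oc : Om p u c (X p) != 0.
  pose M : 'M[R]_3 := \matrix_(i, j)
    if i == 0 then u 0 j else if i == 1 then c 0 j else X p 0 j.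
  have -> : u = row 0 M by apply/rowP => j; rewrite !mxE.
  have -> : c = row 1 M by apply/rowP => j; rewrite [RHS]mxE [RHS]mxE.
  have -> : X p = row ord_max M by apply/rowP => j; rewrite !mxE.
  rewrite three_form_det mulf_neq0//; last first.
    apply/eqP => O0; have [v1 [v2 [v3]]] := Om0 p.
    pose N : 'M[R]_3 := \matrix_(i, j)
      if i == 0 then v1 0 j else if i == 1 then v2 0 j else v3 0 j.
    have -> : v1 = row 0 N by apply/rowP => j; rewrite !mxE.
    have -> : v2 = row 1 N by apply/rowP => j; rewrite !mxE.
    have -> : v3 = row ord_max N by apply/rowP => j; rewrite !mxE.
    by rewrite three_form_det O0 mulr0 eqxx.
  have -> : \det M = c 0 0 ^+ 2 + c 0 1 ^+ 2 + c 0 ord_max ^+ 2.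
    rewrite (expand_det_row _ ord0) !big_ord_recl big_ord0 /cofactor.
    rewrite !(expand_det_row _ ord0) !big_ord_recl !big_ord0 /cofactor !det_mx11.
    have [m mE] : exists m : nat -> R, forall j : 'I_3, u 0 j = m j.
      by exists (fun j => u 0 (inord j)) => j; rewrite !inord_val.
    have [q qE] : exists m : nat -> R, forall j : 'I_3, X p 0 j = m j.
      by exists (fun j => X p 0 (inord j)) => j; rewrite !inord_val.
    by rewrite !mxE /= !mE !qE /= /bump /=; ring.
  rewrite gt_eqF// lt_def !addr_ge0 ?sqr_ge0// andbT.
  apply/negP; rewrite !paddr_eq0 ?addr_ge0 ?sqr_ge0// !sqrf_eq0.
  rewrite !mxE /= !subr_eq0 => /andP[/andP[/eqP c1 /eqP c2] /eqP c3].
  have X0 : X p = 0.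
    have uX i j : u 0 i * X p 0 j = u 0 j * X p 0 i.
      have I3 (k : 'I_3) : [\/ k = 0, k = 1 | k = ord_max].
        case: k => [[|[|[|//]]] hk]; [apply: Or31|apply: Or32|apply: Or33];
          exact/val_inj.
      case: (I3 i) => ->; case: (I3 j) => -> //;
        rewrite mulrC [RHS]mulrC; first [exact: c1|exact: c2|exact: c3|
          exact: esym c1|exact: esym c2|exact: esym c3].
    apply/rowP => j; rewrite mxE; apply: (mulIf wu).
    have lw : scalar (w p) by move=> a v v'; rewrite linearP.
    rewrite mul0r; transitivity (u 0 j * w p (X p)); last by rewrite wX ?mulr0.
    rewrite (scalar_expand u lw) (scalar_expand (X p) lw) !mulr_sumr.
    by apply: eq_bigr => i _; rewrite !mulrA [X p 0 j * _]mulrC uX.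
  by have := line_dim L p; rewrite LX// X0 dim_vline eqxx.
pose a x : R^o := w x u.
pose b x : R^o := Om x u c (X x).
pose V1 := V0 `&` [set x | a x != 0].
pose V := V1 `&` [set x | b x != 0].
have oV1 : open_in V1 by apply: open_in_neq0 => //; exact: form_smooth_restr.
have sOm V' v v' : open_in V' -> V' `<=` V0 ->
    body_smooth_on V' (fun x => Om x v v' (X x) : R^o).
  move=> oV' V'V0; apply: (@body_smooth_scalar _ (fun x => Om x v v')) => //.
  - by move=> x; exact: (@three_form_linear3 _ _ Om x v v').
  - by move=> v''; exact: (@body_smooth_subset setT V' _ _ _ (three_form_smooth Om v v' v'')).
  exact: body_smooth_subset sX.
have oV : open_in V.
  by apply: open_in_neq0 => //; apply: sOm => // x [].
have VV0 : V `<=` V0 by move=> x [[]].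
have Va x : V x -> a x != 0 by move=> [[]].
have Vb x : V x -> b x != 0 by move=> [].
have sa : body_smooth_on V a by exact: form_smooth_restr.
have sb : body_smooth_on V b by exact: sOm.
pose s x : 'M[R]_3 := \matrix_(i, j)
  if i == 0 then (a x)^-1 * u 0 j
  else if i == 1 then (b x)^-1 * (a x * c 0 j + - 1 * (w x c * u 0 j))
  else X x 0 j.
have s0 x : row 0 (s x) = (a x)^-1 *: u by apply/rowP => j; rewrite !mxE.
have s1 x : row 1 (s x) = (b x)^-1 *: (a x *: c - w x c *: u).
  apply/rowP => j; rewrite [LHS]mxE [LHS]mxE /= mulN1r [RHS]mxE.
  rewrite [X in _ = _ * X]mxE [X in _ = _ * (_ + X)]mxE.
  by rewrite [X in _ = _ * (X - _)]mxE [X in _ = _ * (_ - X)]mxE.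
have s2 x : row ord_max (s x) = X x by apply/rowP => j; rewrite !mxE.
exists V, s; split => //.
  apply/(body_smooth_mx _ oV) => i j.
  have -> : (fun x => s x i j : R^o) = fun x =>
    if i == 0 then (a x)^-1 * u 0 j
    else if i == 1 then (b x)^-1 * (a x * c 0 j + - 1 * (w x c * u 0 j))
    else X x 0 j by apply/funext => x; rewrite [LHS]mxE.
  have scst (r : R^o) : body_smooth_on V (fun=> r) by exact: body_smooth_cst.
  case: (i == 0).
    by apply: body_smoothM => //; exact: body_smoothV.
  case: (i == 1).
    apply: body_smoothM => //; first exact: body_smoothV.
    apply: body_smoothD => //; first by apply: body_smoothM.
    apply: body_smoothM => //; apply: body_smoothM => //.
    exact: form_smooth_restr.
  by have := body_smooth_subset VV0 sX; move/(body_smooth_mx _ oV) => /(_ 0 j).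
move=> x Vx; have ax := Va x Vx; have bx := Vb x Vx.
have O1 : Om x (row 0 (s x)) (row 1 (s x)) (row ord_max (s x)) = 1.
  have S1 k v v' v'' : Om x (k *: v) v' v'' = k * Om x v v' v''.
    have := @three_form_linear1 _ _ Om x v' v'' k v 0.
    have := @three_form_linear1 _ _ Om x v' v'' (-1) 0 0.
    by rewrite scaler0 addr0 => {1}->; rewrite /= mulN1r addNr !addr0.
  have S2 k v v' v'' : Om x v (k *: v') v'' = k * Om x v v' v''.
    have := @three_form_linear2 _ _ Om x v v'' k v' 0.
    have := @three_form_linear2 _ _ Om x v v'' (-1) 0 0.
    by rewrite scaler0 addr0 => {1}->; rewrite /= mulN1r addNr !addr0.
  rewrite s0 s1 s2 S1 S2 three_form_linear2 -scaleNr S2 three_form_alt12 mulr0.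
  by rewrite addr0 -/(b x) /= (mulrCA (b x)^-1) mulVf// mulr1 mulVf.
have wr1 : w x (row 0 (s x)) = 1 by rewrite s0 linearZ /= mulVf.
have wr2 : w x (row 1 (s x)) = 0.
  rewrite s1 linearZ /= linearB !linearZ /= -/(a x).
  by rewrite /GRing.scale /= mulrN (mulrC (a x)) subrr mulr0.
split => //.
- rewrite unitmxE unitfE; apply: contraTN isT => /eqP d0.
  by move: O1; rewrite three_form_det d0 mul0r => /esym/eqP; rewrite oner_eq0.
- by rewrite wr2 s2 wX//; exact: VV0.
by rewrite s2 LX//; exact: VV0.
Qed.

Definition G1B_structure (w : one_form B) (L : line_distribution B)
    (Om : three_form B) (w0 : without_zeros w)
    (wL : forall x v, v \in L x -> w x v = 0) (Om0 : is_volume_form Om) :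
    g_structure B G1B :=
  @GStructure R B G1B (G1B_frames w L Om)
    (@G1B_frames_unit w L Om) (@G1B_frames_act w L Om)
    (@G1B_frames_trans w L Om) (G1B_frames_section w0 wL Om0).

End body_calculus.

(* Main.v *)
(* If P is integrable by coordinates (x^i), then omega = dx^1, so omega is closed by
   symmetry of second derivatives. Conversely, let (Y, Z, X) be a smooth local section
   of P and let Theta(a, b, z) = Fl_X^z (Fl_Z^b (Fl_Y^a p)). As omega is closed and
   omega(Z) = omega(X) = 0, the components of Theta^* omega are constant along the
   successive flows, whence Theta^* omega = da, while d/dz spans L. Reparametrizing z
   along the flow of kappa^-1 d/dz, where Theta^* Omega = kappa da/\db/\dz, gives
   moreover unit volume, and the inverse function theorem turns the result into local
   coordinates. *)

Require Import Defs.
From HB Require Import structures.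
From mathcomp Require Import all_boot all_order all_algebra.
From mathcomp Require Import all_classical all_reals all_analysis.
From mathcomp Require Import ring lra.
Import Order.TTheory GRing.Theory Num.Theory.
Import numFieldNormedType.Exports.

Set Implicit Arguments.
Unset Strict Implicit.
Unset Printing Implicit Defensive.

Local Open Scope classical_set_scope.
Local Open Scope ring_scope.

(** * C^k calculus *)

(** The analytic weight lies in the flows: [Theta] must be smooth jointly in times and initial
    point. To express this with [Ck_on], one coordinate of a cube in R^n serves as time and the
    others as parameters; a flow is then a function on a cube, and one flow can be the initial data
    of the next. Differentiability in the parameters rests on Hadamard's factorization f y - f x =
    (y - x) *m H x y: it makes the equation for a difference of two solutions exactly linear,
    without remainder, and conversely a factorization with continuous factor gives
    differentiability. The same device serves the inverse function theorem. Cubes are small enough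
    that Lipschitz constant times radius is at most 1/2, so Picard's operator halves distances and
    no exponential bounds occur. The field spanning L is flowed last because only the last
    coordinate direction stays tangent to its field off the initial hyperplane. Volume can then be
    corrected along L alone: changing only the last coordinate keeps a and b, hence da, and keeps
    the line spanned by d/dz. *)

Section row_norm.
Context {R : realType} {m n : nat}.
Implicit Types v : 'M[R]_(m, n).

Lemma mx_norm_leP v (c : R) : 0 <= c ->
  reflect (forall i j, `|v i j| <= c) (`|v| <= c).
Proof.
move=> c0; rewrite [`|v|]mx_normrE; apply: (iffP idP) => [vc i j|vc].
  by apply: le_trans vc; exact: (le_bigmax _ _ (i, j)).
by apply: bigmax_le => // -[i j] _; exact: vc.
Qed.

Lemma mx_entry_le_norm v i j : `|v i j| <= `|v|.
Proof. by move: i j; apply: (elimT (mx_norm_leP _ (normr_ge0 v))). Qed.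

End row_norm.

Section mulmx_norm.
Context {R : realType} {m n : nat}.
Implicit Types v : 'M[R]_(m, n).

(** The norm is the largest entry in absolute value, and an entry of the product is a sum of [n]
    terms. This is the origin of the constants [m%:R * C] in the estimates below. *)
Lemma mulmx_norm_le p (A : 'M[R]_(n, p)) v (c : R) : 0 <= c ->
  (forall i j, `|A i j| <= c) -> `|v *m A| <= n%:R * c * `|v|.
Proof.
move=> c0 Ac; apply: (introT (mx_norm_leP _ _)) => [|i j].
  by rewrite !mulr_ge0.
rewrite mxE (le_trans (ler_norm_sum _ _ _))//.
apply: le_trans (_ : \sum_(k < n) c * `|v| <= _); last first.
  by rewrite sumr_const card_ord -mulrA [leRHS]mulr_natl.
apply: ler_sum => k _.
by rewrite normrM mulrC ler_pM// ?Ac// mx_entry_le_norm.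
Qed.

Lemma cvg_mxP (T : Type) (F : set_system T) (f : T -> 'M[R]_(m, n)) v :
  Filter F ->
  (f x @[x --> F] --> v) <->
  (forall i j, f x i j @[x --> F] --> v i j).
Proof.
move=> FF; split=> [fv i j|fv].
  exact: (cvg_comp _ _ fv (@coord_continuous _ _ _ i j v)).
apply/cvgrPdist_le => /= e e0.
have : \forall x \near F, forall ij : 'I_m * 'I_n, `|v ij.1 ij.2 - f x ij.1 ij.2| <= e.
  apply: filter_forall => -[i j].
  by have /cvgrPdist_le /(_ _ e0) := fv i j.
apply: filterS => x vx; apply: (introT (mx_norm_leP _ (ltW e0))) => i j.
by rewrite !mxE; exact: (vx (i, j)).
Qed.

End mulmx_norm.

Lemma for_continuousP {R : realType} (T : topologicalType) (W : normedModType R)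
    (f : T -> W) (x : T) :
  {for x, continuous f} <->
  (forall e, 0 < e -> \forall y \near x, `|f x - f y| <= e).
Proof. by split=> [/cvgrPdist_le|fx]//; apply/cvgrPdist_le. Qed.

Section directional.
Context {R : realType} {n : nat}.
Local Notation "'e_ i" := (delta_mx 0 i : 'rV[R]_n) (at level 8, i at level 2).

Lemma derive_sum_basis (W : normedModType R) (f : 'rV[R]_n -> W) x v :
  differentiable f x -> 'D_v f x = \sum_i v 0 i *: 'D_('e_i) f x.
Proof.
move=> df; rewrite deriveE// {1}(row_sum_delta v) linear_sum.
by apply: eq_bigr => i _; rewrite linearZ /= deriveE.
Qed.

Lemma derive_comp_diff (W W' : normedModType R) (f : W -> W')
    (g : 'rV[R]_n -> W) x v : differentiable g x -> differentiable f (g x) ->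
  'D_v (f \o g) x = 'D_('D_v g x) f (g x).
Proof.
move=> dg df; rewrite !deriveE//; last exact: differentiable_comp.
by rewrite diff_comp.
Qed.

End directional.

Section Ck_calculus.
Context {R : realType} {n : nat}.
Implicit Types U : set 'rV[R]_n.

(** [Ck_on] is a pointwise condition on a total function and its total iterated derivatives, so each
    point may be handled in its own [V]. This lets regularity be proved on the smaller cubes where
    auxiliary solutions exist. *)
Lemma Ck_local k U (W : normedModType R) (f : 'rV[R]_n -> W) :
  (forall x, U x -> exists2 V, V x & Ck_on k V f) -> Ck_on k U f.
Proof.
elim: k f => [|k IH] f H /=.
  by move=> u /H [V Vu]; exact.
split=> [u /H [V Vu [dV _]]|v]; first exact: dV.
by apply: IH => x /H [V Vu [_ cV]]; exists V => //; exact: cV.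
Qed.

Lemma Ck_le j k U (W : normedModType R) (f : 'rV[R]_n -> W) :
  (j <= k)%N -> Ck_on k U f -> Ck_on j U f.
Proof.
move=> /subnK <-; elim: (k - j)%N => [|i IH]//.
by rewrite addSn => /Ck_pred; exact: IH.
Qed.

Lemma Ck_sum k U (I : Type) (r : seq I) (P : pred I) (f : I -> 'rV[R]_n -> R^o) :
  open U -> (forall i, P i -> Ck_on k U (f i)) ->
  Ck_on k U (fun x => \sum_(i <- r | P i) f i x : R^o).
Proof.
move=> oU cf; elim: r => [|i r IH].
  by under eq_fun do rewrite big_nil; exact: Ck_cst.
under eq_fun do rewrite big_cons.
by case Pi : (P i) => //; apply: CkD => //; exact: cf.
Qed.

Lemma Ck_prod k U (I : Type) (r : seq I) (P : pred I) (f : I -> 'rV[R]_n -> R^o) :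
  open U -> (forall i, P i -> Ck_on k U (f i)) ->
  Ck_on k U (fun x => \prod_(i <- r | P i) f i x : R^o).
Proof.
move=> oU cf; elim: r => [|i r IH].
  by under eq_fun do rewrite big_nil; exact: Ck_cst.
under eq_fun do rewrite big_cons.
by case Pi : (P i) => //; apply: CkM => //; exact: cf.
Qed.

Lemma Ck_continuous k U (W : normedModType R) (f : 'rV[R]_n -> W) :
  Ck_on k U f -> forall u, U u -> {for u, continuous f}.
Proof. by move=> /(@Ck_le 0) cf u; exact: cf. Qed.

Lemma Ck_id k U : Ck_on k U (id : 'rV[R]_n -> 'rV[R]_n).
Proof.
case: k => [|k]; first by move=> u _; exact: cvg_id.
split=> [u _|v]; first exact: ex_diff.
have -> : 'D_v id = fun=> v :> 'rV[R]_n by apply/funext => u; rewrite derive_id.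
exact: Ck_cst.
Qed.

(** For a differentiable function every directional derivative is a constant combination of the
    partial ones. Regularity is gained in this form in all the bootstrap arguments below. *)
Lemma Ck_basis k U (f : 'rV[R]_n -> R^o) : open U ->
  (forall u, U u -> differentiable f u) ->
  (forall i, Ck_on k U ('D_(delta_mx 0 i) f)) -> Ck_on k.+1 U f.
Proof.
move=> oU df cf; split=> // v.
apply: (@Ck_ext _ _ _ _ _
    (fun x => \sum_i (v 0 i : R^o) * 'D_(delta_mx 0 i) f x : R^o)) => //.
  by move=> u Uu; rewrite [RHS]derive_sum_basis//; exact: df.
by apply: Ck_sum => // i _; apply: CkM => //; exact: Ck_cst.
Qed.

Lemma Ck_mx_basis k U p q (f : 'rV[R]_n -> 'M[R]_(p, q)) : open U ->
  (forall u, U u -> differentiable f u) ->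
  (forall i, Ck_on k U ('D_(delta_mx 0 i) f)) -> Ck_on k.+1 U f.
Proof.
move=> oU df cf; apply/(Ck_mx _ _ oU) => i j.
have dfij u : U u -> differentiable (fun x => f x i j : R^o) u.
  move=> Uu; exact: (@differentiable_comp _ _ _ R^o f
    (fun M : 'M[R]_(p, q) => M i j : R^o) u (df u Uu)
    (@differentiable_coord _ _ _ (f u) i j)).
apply: Ck_basis => // l; have /(Ck_mx _ _ oU) /(_ i j) := cf l.
apply: Ck_ext => // u Uu; rewrite derive_mx ?mxE//.
by apply: diff_derivable; exact: df.
Qed.

(** By the chain rule a derivative of the composite is a sum of products of derivatives of [g] with
    composites of partial derivatives of [f], to which the induction hypothesis applies. *)
Lemma Ck_comp m k U (V : set 'rV[R]_m) (f : 'rV[R]_m -> R^o)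
    (g : 'rV[R]_n -> 'rV[R]_m) : open U -> (forall x, U x -> V (g x)) ->
  Ck_on k V f -> Ck_on k U g -> Ck_on k U (f \o g).
Proof.
move=> oU UV; elim: k f => [|k IH] f cf cg.
  by move=> u Uu; apply: continuous_comp; [exact: cg|exact/cf/UV].
split=> [u Uu|v].
  by apply: differentiable_comp; [exact: cg.1|exact/cf.1/UV].
apply: (@Ck_ext _ _ _ _ _ (fun x => \sum_j
  ('D_v g x 0 j : R^o) * ('D_(delta_mx 0 j) f \o g) x : R^o)) => //.
  move=> u Uu; have dg := cg.1 u Uu; have df := cf.1 _ (UV u Uu).
  by rewrite (derive_comp_diff v dg df) [RHS]derive_sum_basis.
apply: Ck_sum => // j _; apply: CkM => //.
  by have /(Ck_mx _ _ oU) := cg.2 v; exact.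
by apply: IH; [exact: cf.2|exact: Ck_pred].
Qed.

Lemma Ck_comp_mx m p q k U (V : set 'rV[R]_m) (f : 'rV[R]_m -> 'M[R]_(p, q))
    (g : 'rV[R]_n -> 'rV[R]_m) : open U -> open V ->
  (forall x, U x -> V (g x)) ->
  Ck_on k V f -> Ck_on k U g -> Ck_on k U (f \o g).
Proof.
move=> oU oV UV cf cg; apply/(Ck_mx _ _ oU) => i j.
apply: (@Ck_comp _ _ _ V (fun x => f x i j)) => //.
by have /(Ck_mx _ _ oV) := cf; exact.
Qed.

Lemma Ck_mulmx p q r k U (f : 'rV[R]_n -> 'M[R]_(p, q))
    (g : 'rV[R]_n -> 'M[R]_(q, r)) : open U ->
  Ck_on k U f -> Ck_on k U g -> Ck_on k U (fun x => f x *m g x).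
Proof.
move=> oU cf cg; apply/(Ck_mx _ _ oU) => i j.
under eq_fun do rewrite mxE.
apply: Ck_sum => // l _; apply: CkM => //.
  by have /(Ck_mx _ _ oU) := cf; exact.
by have /(Ck_mx _ _ oU) := cg; exact.
Qed.

Lemma Ck_mxD p q k U (f g : 'rV[R]_n -> 'M[R]_(p, q)) : open U ->
  Ck_on k U f -> Ck_on k U g -> Ck_on k U (fun x => f x + g x).
Proof.
move=> oU cf cg; apply/(Ck_mx _ _ oU) => i j.
under eq_fun do rewrite mxE.
apply: CkD => //.
  by have /(Ck_mx _ _ oU) := cf; exact.
by have /(Ck_mx _ _ oU) := cg; exact.
Qed.

Lemma Ck_det p k U (f : 'rV[R]_n -> 'M[R]_p) : open U ->
  Ck_on k U f -> Ck_on k U (fun x => \det (f x) : R^o).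
Proof.
move=> oU /(Ck_mx _ _ oU) cf; rewrite /determinant.
apply: Ck_sum => // s _; apply: CkM => //; first exact: Ck_cst.
exact: Ck_prod.
Qed.

(** Cramer's formula reduces inversion to determinants and one division. *)
Lemma Ck_invmx p k U (f : 'rV[R]_n -> 'M[R]_p) : open U ->
  (forall x, U x -> f x \in unitmx) ->
  Ck_on k U f -> Ck_on k U (fun x => invmx (f x)).
Proof.
move=> oU fu cf; apply/(Ck_mx _ _ oU) => i j.
apply: (@Ck_ext _ _ _ _ _ (fun x => (\det (f x))^-1 * cofactor (f x) j i : R^o)) => //.
  by move=> x Ux; rewrite /invmx fu// !mxE.
apply: CkM => //.
  apply: CkV => //; last exact: Ck_det.
  by move=> u /fu; rewrite unitmxE unitfE.
apply: CkM => //; first exact: Ck_cst.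
apply: Ck_det => //; apply/(Ck_mx _ _ oU) => a b.
under eq_fun do rewrite !mxE.
by have /(Ck_mx _ _ oU) := cf; exact.
Qed.

End Ck_calculus.

(** * Symmetry of second derivatives, mean value inequalities *)

Section one_variable.
Context {R : realType}.

Lemma is_derive_line (V W : normedModType R) (f : V -> W) (a v : V) (t : R) :
  derivable f (a + t *: v) v ->
  is_derive t 1 (fun s : R => f (a + s *: v)) ('D_v f (a + t *: v)).
Proof.
move=> df.
have E : (fun h : R => h^-1 *: (f (a + (h *: (1 : R^o) + t) *: v) - f (a + t *: v))) =
         (fun h : R => h^-1 *: (f (h *: v + (a + t *: v)) - f (a + t *: v))).
  by apply/funext => h; rewrite scalerDl [h *: 1]mulr1 addrCA.
by apply: DeriveDef; rewrite /derivable /derive /= E.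
Qed.

Lemma is_derive_continuous (W : normedModType R) (f : R -> W) (t : R) df :
  is_derive t 1 f df -> {for t, continuous f}.
Proof.
move=> [dft _]; apply: differentiable_continuous.
exact/derivable1_diffP.
Qed.

Lemma within_continuous (T : topologicalType) (f : R -> T) (A : set R) :
  (forall t, A t -> {for t, continuous f}) -> {within A, continuous f}.
Proof.
move=> cf; apply: continuous_in_subspaceT => t; rewrite inE; exact: cf.
Qed.

Lemma MVT0 (f df : R -> R) (b : R) : 0 < b ->
  (forall t, 0 <= t <= b -> is_derive t 1 f (df t)) ->
  exists2 c, 0 <= c <= b & f b - f 0 = b * df c.
Proof.
move=> b0 fdf.
have [t||c] := @MVT R f df 0 b b0.
- by rewrite in_itv /= => /andP[t0 tb]; apply: fdf; rewrite !ltW.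
- apply: within_continuous => t /=; rewrite in_itv /= => tb.
  exact: is_derive_continuous (fdf t tb).
rewrite in_itv /= => /andP[c0 cb] ->; exists c; first by rewrite !ltW.
by rewrite subr0 mulrC.
Qed.

End one_variable.

Section schwarz.
Context {R : realType} {n : nat}.

(** The mean value theorem is applied along [u] to the increment of [f] in direction [v], then along
    [v] to ['D_u f]. *)
Lemma second_difference (f : 'rV[R]_n -> R^o) U x u v (s : R) : 0 < s ->
  (forall i j, 0 <= i <= s -> 0 <= j <= s -> U (x + i *: u + j *: v)) ->
  Ck_on 2 U f ->
  exists i j, [/\ 0 <= i <= s, 0 <= j <= s &
    f (x + s *: u + s *: v) - f (x + s *: u) - (f (x + s *: v) - f x) =
    s * (s * 'D_v ('D_u f) (x + i *: u + j *: v))].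
Proof.
move=> s0 Us [df cf].
have s01 : 0 <= s <= s by rewrite lexx ltW.
have s00 : 0 <= (0 : R) <= s by rewrite lexx ltW.
pose g (i : R) : R := f (x + i *: u + s *: v) - f (x + i *: u).
have [i si|i si gE] := @MVT0 R g (fun i => 'D_u f (x + i *: u + s *: v) - 'D_u f (x + i *: u)) s s0.
  have d1 : is_derive i (1 : R) (fun i : R => f (x + i *: u + s *: v) : R^o)
      ('D_u f (x + i *: u + s *: v)).
    have := @is_derive_line R _ _ f (x + s *: v) u i.
    under eq_fun do rewrite addrAC.
    rewrite addrAC; apply; apply: diff_derivable; apply: df; exact: Us.
  have d2 : is_derive i (1 : R) (fun i : R => f (x + i *: u) : R^o)
      ('D_u f (x + i *: u)).
    apply: is_derive_line; apply: diff_derivable; apply: df.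
    by have := Us _ _ si s00; rewrite scale0r addr0.
  exact: is_deriveB.
pose h (j : R) : R := 'D_u f (x + i *: u + j *: v).
have [j sj|j sj hE] := @MVT0 R h (fun j => 'D_v ('D_u f) (x + i *: u + j *: v)) s s0.
  apply: is_derive_line; apply: diff_derivable.
  by apply: (cf u).1; exact: Us.
exists i, j; split=> //.
by rewrite -hE /h scale0r addr0 -gE /g scale0r addr0.
Qed.

(** The second difference is symmetric in [u] and [v], so both mixed derivatives take a common value
    at points arbitrarily close to [x]; continuity concludes. *)
Lemma schwarz (f : 'rV[R]_n -> R^o) U x u v : open U -> U x ->
  Ck_on 2 U f -> 'D_u ('D_v f) x = 'D_v ('D_u f) x.
Proof.
move=> oU Ux cf; apply/eqP; rewrite -subr_eq0 -normr_le0; apply/ler_addgt0Pl => e e0.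
rewrite addr0.
pose p : 'rV[R]_n -> R := 'D_u ('D_v f); pose q : 'rV[R]_n -> R := 'D_v ('D_u f).
have c1 : {for x, continuous p} by apply: (cf.2 v).2.
have c2 : {for x, continuous q} by apply: (cf.2 u).2.
rewrite -[X in X - _]/(p x) -[X in _ - X]/(q x).
have e2 : 0 < e / 2 by rewrite divr_gt0.
have oUx : nbhs x U by exact: open_nbhs_nbhs.
move/cvgrPdist_lt : c1 => /(_ _ e2) c1; move/cvgrPdist_lt : c2 => /(_ _ e2) c2.
have /nbhs_ballP[d /= d0 dU] : nbhs x [set y | [/\ U y,
    `|p x - p y| < e / 2 & `|q x - q y| < e / 2]].
  by apply: filterS (filterI oUx (filterI c1 c2)) => y [h [h1 h2]]; exact: And3 h h1 h2.
(* The added 1 makes [c] positive and strictly larger than the two norms, so the parallelogram of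
   side parameter [d / c] lies in the open ball of radius [d]. *)
pose c := `|u| + `|v| + 1.
have c0 : 0 < c by rewrite ltr_wpDl// addr_ge0.
pose s := d / c.
have s0 : 0 < s by rewrite divr_gt0.
have inball i j w w' : `|w| + `|w'| < c -> 0 <= i <= s -> 0 <= j <= s ->
    ball x d (x + i *: w + j *: w').
  move=> wc /andP[i0 si] /andP[j0 sj].
  rewrite -ball_normE /= -!addrA opprD addNKr normrN.
  apply: (le_lt_trans (ler_normD _ _)); rewrite !normrZ !ger0_norm//.
  apply: le_lt_trans (_ : s * (`|w| + `|w'|) < _).
    by rewrite mulrDr lerD// ler_wpM2r.
  by rewrite /s mulrAC ltr_pdivrMr// ltr_pM2l.
have uvc : `|u| + `|v| < c by rewrite ltrDl.
have vuc : `|v| + `|u| < c by rewrite addrC.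
have [i [j [si sj E1]]] := second_difference s0
  (fun i j si sj => let: And3 h _ _ := dU _ (inball i j u v uvc si sj) in h) cf.
have [i' [j' [si' sj' E2]]] := second_difference s0
  (fun i j si sj => let: And3 h _ _ := dU _ (inball i j v u vuc si sj) in h) cf.
have E : q (x + i *: u + j *: v) = p (x + i' *: v + j' *: u).
  apply: (mulfI (lt0r_neq0 s0)); apply: (mulfI (lt0r_neq0 s0)).
  have sub4 (a b c' d' : R) : a - b - (c' - d') = a - c' - (b - d') by ring.
  rewrite -[LHS]E1 -[RHS]E2 [X in f X - _ - _ = _]addrAC; exact: sub4.
have [_ _ H1] := dU _ (inball _ _ _ _ uvc si sj).
have [_ H2 _] := dU _ (inball _ _ _ _ vuc si' sj').
rewrite (splitr e); apply: le_trans (lerD (ltW H2) (ltW H1)).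
rewrite -E [X in _ <= _ + X]distrC; exact: ler_distD.
Unshelve. all: by end_near. Qed.

End schwarz.

Section mean_value_inequality.
Context {R : realType}.

(** The interval is symmetric because flows run in both time directions; negative times reduce to
    positive ones by reflection. *)
Lemma MVI_real (f df : R -> R) (h C : R) :
  (forall t : R, `|t| <= h -> is_derive t 1 f (df t)) ->
  (forall t : R, `|t| <= h -> `|df t| <= C) ->
  forall t : R, `|t| <= h -> `|f t - f 0| <= C * `|t|.
Proof.
have key (g dg : R -> R) (t : R) : 0 <= t <= h ->
  (forall t : R, `|t| <= h -> is_derive t 1 g (dg t)) ->
  (forall t : R, `|t| <= h -> `|dg t| <= C) -> `|g t - g 0| <= C * `|t|.
  move=> /andP[]; rewrite le_eqVlt => /orP[/eqP <- _ _ _|t0 th dg' Cg].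
    by rewrite subrr !normr0 mulr0.
  have H s : 0 <= s <= t -> `|s| <= h.
    by move=> /andP[s0 st]; rewrite ger0_norm// (le_trans st).
  have [c ct ->] := MVT0 t0 (fun s st => dg' s (H s st)).
  by rewrite normrM mulrC ler_wpM2r// Cg// H.
move=> fd Cd t th; case: (leP 0 t) => t0.
  by apply: (key f df) => //; rewrite t0 -(ger0_norm t0).
pose g s := f (- s).
have -> : f t = g (- t) by rewrite /g opprK.
have -> : f 0 = g 0 by rewrite /g oppr0.
rewrite -(normrN t); apply: (key g (fun s => df (- s) * - 1)).
- by rewrite oppr_ge0 ltW//= -(ltr0_norm t0).
- move=> s sh; apply: (@is_derive1_comp R f (fun x : R => - x) s).
  by apply: fd; rewrite normrN.
by move=> s sh; rewrite mulrN1 normrN; apply: Cd; rewrite normrN.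
Qed.

Lemma is_derive_mxP (V : normedModType R) p q (f : V -> 'M[R]_(p, q)) (t v : V) df :
  is_derive t v f df <-> forall i j, is_derive t v (fun x => f x i j) (df i j).
Proof.
split=> [[dft <-] i j|H].
  apply: DeriveDef; first by move/derivable_mxP : dft; exact.
  by rewrite derive_mx// mxE.
have dft : derivable f t v by apply/derivable_mxP => i j; apply: ex_derive.
apply: DeriveDef => //; rewrite derive_mx//; apply/matrixP => i j.
by rewrite mxE derive_val.
Qed.

(** With the largest-entry norm the scalar inequality in each entry suffices and the constant is not
    lost. *)
Lemma MVI p q (f df : R -> 'M[R]_(p, q)) (h C : R) :
  (forall t : R, `|t| <= h -> is_derive t 1 f (df t)) ->
  (forall t : R, `|t| <= h -> `|df t| <= C) ->
  forall t : R, `|t| <= h -> `|f t - f 0| <= C * `|t|.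
Proof.
move=> fd Cd t th.
have C0 : 0 <= C by apply: le_trans (Cd 0 _) => //; rewrite normr0 (le_trans _ th).
apply: (introT (mx_norm_leP _ _)) => [|i j]; first by rewrite mulr_ge0.
rewrite !mxE; apply: (@MVI_real (fun s => f s i j) (fun s => df s i j) h C) => // s sh.
  by have /is_derive_mxP := fd s sh; exact.
by apply: le_trans (Cd s sh); exact: mx_entry_le_norm.
Qed.

(* Gronwall's inequality without the exponential: as [K h <= 1/2], evaluating at
   a maximum of [|r|] and absorbing the linear term is enough. *)
Lemma short_gronwall p q (r dr : R -> 'M[R]_(p, q)) (h K e : R) :
  0 <= K -> 0 <= e -> K * h <= 2^-1 ->
  (forall t : R, `|t| <= h -> is_derive t 1 r (dr t)) ->
  (forall t : R, `|t| <= h -> `|dr t| <= K * `|r t| + e) ->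
  forall t : R, `|t| <= h -> `|r t| <= 2 * (`|r 0| + h * e).
Proof.
move=> K0 e0 Kh rd dre t th.
have h0 : 0 <= h by exact: le_trans th.
have [||c] := @EVT_max R (fun s => `|r s|) (- h) h.
- by rewrite (@le_trans _ _ 0)// oppr_le0.
- apply: within_continuous => s /=; rewrite in_itv /= -ler_norml => sh.
  have := is_derive_continuous (rd s sh).
  by move=> rs; apply: (@continuous_comp _ _ _ r Num.norm) => //; exact: norm_continuous.
rewrite in_itv /= -ler_norml => ch cmax.
have {}cmax s : `|s| <= h -> `|r s| <= `|r c|.
  by move=> sh; apply: cmax; rewrite in_itv /= -ler_norml.
apply: le_trans (cmax t th) _.
have H : `|r c - r 0| <= (K * `|r c| + e) * `|c|.
  apply: (MVI rd) => // s sh; apply: le_trans (dre s sh) _.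
  by rewrite lerD2r ler_wpM2l// cmax.
have H1 : (K * `|r c| + e) * `|c| <= 2^-1 * `|r c| + h * e.
  apply: le_trans (_ : (K * `|r c| + e) * h <= _).
    by rewrite ler_wpM2l// addr_ge0// mulr_ge0.
  rewrite mulrDl (mulrC e) lerD2r mulrAC.
  by rewrite ler_wpM2r.
have H2 : `|r c| <= `|r 0| + `|r c - r 0| by rewrite -[in leLHS](subrKC (r 0) (r c)) ler_normD.
lra.
Qed.

End mean_value_inequality.

(** * Primitives and Picard iteration *)

Section clamp.
Context {R : realType}.
Implicit Types a b t : R.

(** For [a <= b], the retraction of the line onto [a, b]; it extends data given on an interval to
    the whole line while keeping Lipschitz bounds. *)
Definition clamp a b t : R := Num.max a (Num.min b t).

Lemma clamp_in a b t : a <= b -> a <= clamp a b t <= b.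
Proof.
move=> ab; rewrite /clamp.
case: (leP b t) => bt; first by case: (leP a b) => ?; lra.
by case: (leP a t) => ?; lra.
Qed.

Lemma clamp_id a b t : a <= t <= b -> clamp a b t = t.
Proof.
move=> /andP[at_ tb]; rewrite /clamp.
by rewrite (min_idPr tb) (max_idPr at_).
Qed.

Lemma clamp_lip a b s t : `|clamp a b s - clamp a b t| <= `|s - t|.
Proof.
rewrite /clamp ler_norml; have := ler_norm (s - t); have := ler_norm (t - s).
rewrite (distrC t s); move: `|s - t| => d d1 d2.
have [bs|sb] := leP b s; have [bt|tb] := leP b t;
  [have [ab|ba] := leP a b|have [ab|ba] := leP a b; have [a2|a2] := leP a t
  |have [ab|ba] := leP a b; have [a2|a2] := leP a s
  |have [ab|ba] := leP a s; have [a2|a2] := leP a t]; apply/andP; split; lra.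
Qed.

Lemma clamp_continuous a b : continuous (clamp a b).
Proof.
move=> t; apply/cvgrPdist_le => /= e e0.
apply/nbhs_ballP; exists e => // s /ltW.
by apply: le_trans; exact: clamp_lip.
Qed.

End clamp.

Section primitive.
Context {R : realType}.

Lemma primitive_real_exists (f : R -> R) (h : R) : continuous f ->
  exists F : R -> R, F 0 = 0 /\
    forall t : R, `|t| <= h -> is_derive t 1 F (f t).
Proof.
move=> cf; case: (ltP h 0) => h0.
  by exists (fun=> 0); split=> // t th; have := normr_ge0 t; lra.
(* The margin 1 on both sides makes every [t] with [|t| <= h] an interior point of the interval of
   integration. *)
pose G x := (\int[lebesgue_measure]_(t in [set` `[(- h - 1), x]]) f t)%R.
have dG (t : R) : `|t| <= h -> is_derive t 1 G (f t).
  rewrite ler_norml => /andP[ht th].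
  have [||||dG Gf] := @continuous_FTC1_closed R f (- h - 1) t (h + 1).
  - by rewrite (le_lt_trans th)// ltrDl.
  - apply: continuous_compact_integrable; first exact: segment_compact.
    by apply: within_continuous => s _; exact: cf.
  - by rewrite (lt_le_trans _ ht)// gtrDl oppr_lt0.
  - exact: cf.
  by rewrite -Gf derive1E; exact: derivableP.
exists (fun x => G x - G 0); split=> [|t th]; first by rewrite subrr.
have := @is_deriveB _ _ _ G (cst (G 0)) t 1 _ _ (dG t th) (is_derive_cst _ _ _).
by rewrite subr0.
Qed.

Context {p q : nat}.
Implicit Types (f g : R -> 'M[R]_(p, q)) (h : R).

Lemma primitive_exists f (h : R) : continuous f ->
  exists F : R -> 'M[R]_(p, q), F 0 = 0 /\
    forall t : R, `|t| <= h -> is_derive t 1 F (f t).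
Proof.
move=> cf.
have H (ij : 'I_p * 'I_q) : exists F : R -> R, F 0 = 0 /\
    forall t : R, `|t| <= h -> is_derive t 1 F (f t ij.1 ij.2).
  apply: (@primitive_real_exists (fun t => f t ij.1 ij.2)) => t.
  exact: (continuous_comp (cf t) (@coord_continuous _ _ _ _ _ (f t))).
have [F FP] := choice H.
exists (fun t => \matrix_(i, j) F (i, j) t); split.
  by apply/matrixP => i j; rewrite !mxE (FP (i, j)).1.
move=> t th; apply/is_derive_mxP => i j; under eq_fun do rewrite mxE.
exact: (FP (i, j)).2.
Qed.

(** Chosen rather than computed, so only the values on [-h, h] are meaningful, and only for
    continuous [f]. *)
Definition primitive (h : R) f : R -> 'M[R]_(p, q) :=
  get [set F | F 0 = 0 /\ forall t : R, `|t| <= h -> is_derive t 1 F (f t)].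

Lemma primitiveP h f : continuous f -> primitive h f 0 = 0 /\
  forall t : R, `|t| <= h -> is_derive t 1 (primitive h f) (f t).
Proof. by move=> /(primitive_exists h); exact: getPex. Qed.

Lemma primitive_dist h f g (c : R) : continuous f -> continuous g ->
  (forall t : R, `|t| <= h -> `|f t - g t| <= c) ->
  forall t : R, `|t| <= h -> `|primitive h f t - primitive h g t| <= c * `|t|.
Proof.
move=> cf cg fg t th; have [F0 dF] := primitiveP h cf; have [G0 dG] := primitiveP h cg.
suff : `|(primitive h f t - primitive h g t) - (primitive h f 0 - primitive h g 0)| <= c * `|t|.
  by rewrite F0 G0 subrr subr0.
apply: (@MVI R p q (fun t => primitive h f t - primitive h g t) (fun t => f t - g t) h) => // s sh.
exact: (is_deriveB (dF s sh) (dG s sh)).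
Qed.

Lemma primitive_unique h f (F : R -> 'M[R]_(p, q)) : continuous f ->
  (forall t : R, `|t| <= h -> is_derive t 1 F (f t)) ->
  forall t : R, `|t| <= h -> F t = F 0 + primitive h f t.
Proof.
move=> cf dF t th; have [G0 dG] := primitiveP h cf.
have : `|(F t - primitive h f t) - (F 0 - primitive h f 0)| <= 0 * `|t|.
  apply: (@MVI R p q (fun t => F t - primitive h f t) (fun t => f t - f t) h) => // s sh.
    exact: (is_deriveB (dF s sh) (dG s sh)).
  by rewrite subrr normr0.
rewrite G0 subr0 mul0r normr_le0 subr_eq0 => /eqP <-.
by rewrite subrK.
Qed.

End primitive.

Section picard.
Context {R : realType} {p m : nat}.
Variables (F : R -> 'M[R]_(p, m) -> 'M[R]_(p, m)) (K h : R) (u0 : 'M[R]_(p, m)).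
Hypotheses (h0 : 0 <= h) (Kh : K * h <= 2^-1).
Hypothesis cF : forall u : R -> 'M[R]_(p, m), continuous u ->
  continuous (fun t => F t (u t)).
Hypothesis lipF : forall t u v, `|F t u - F t v| <= K * `|u - v|.

(** Picard's integral operator with time frozen outside [-h, h]: iterates are continuous on the
    whole line and their distances are bounded uniformly in [t]. *)
Let T (w : R -> 'M[R]_(p, m)) (t : R) : 'M[R]_(p, m) :=
  u0 + primitive h (fun s => F s (w s)) (clamp (- h) h t).

Let clamp_le t : `|clamp (- h) h t| <= h.
Proof. by rewrite ler_norml clamp_in// ge0_cp. Qed.

Let T_continuous w : continuous w -> continuous (T w).
Proof.
move=> cw t; rewrite /T; apply: cvgD; first exact: cvg_cst.
apply: (@continuous_comp _ _ _ (clamp (- h) h)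
  (primitive h (fun s => F s (w s)))); first exact: clamp_continuous.
have [_ dP] := primitiveP h (cF cw).
exact: is_derive_continuous (dP _ (clamp_le t)).
Qed.

Let T_dist w w' (c : R) : 0 <= K -> continuous w -> continuous w' ->
  (forall t, `|w t - w' t| <= c) -> forall t, `|T w t - T w' t| <= c / 2.
Proof.
move=> K0 cw cw' ww' t.
have c0 : 0 <= c by rewrite (le_trans _ (ww' 0)).
rewrite /T opprD addrACA subrr add0r.
apply: le_trans (_ : (K * c) * `|clamp (- h) h t| <= _).
  apply: (primitive_dist (cF cw) (cF cw')) => // s sh.
  by rewrite (le_trans (lipF _ _ _))// ler_wpM2l.
apply: le_trans (_ : K * c * h <= _).
  by rewrite ler_wpM2l// mulr_ge0.
by rewrite mulrAC mulrC ler_wpM2l.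
Qed.

(** Since [K * h <= 1/2], [T] halves uniform distances. The iterates converge with geometric error,
    and their uniform limit satisfies the integral equation on [-h, h]. *)
Lemma picard : 0 <= K -> exists u : R -> 'M[R]_(p, m), u 0 = u0 /\
  forall t : R, `|t| <= h -> is_derive t 1 u (F t (u t)).
Proof.
move=> K0; pose w n := iter n T (fun=> u0).
have cw n : continuous (w n).
  elim: n => [|n IH]; first by move=> ?; exact: cst_continuous.
  exact: T_continuous.
have [M w1] : exists M, forall t, `|w 1%N t - w 0%N t| <= M.
  have cP : {within `[(- h), h], continuous (fun t => `|w 1%N t - u0|)}.
    apply: within_continuous => t _.
    apply: (@continuous_comp _ _ _ (fun t => w 1%N t - u0) Num.norm); last exact: norm_continuous.
    by apply: continuousB; [exact: (cw 1%N)|exact: cst_continuous].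
  have hh : - h <= h by rewrite ge0_cp.
  have [c _ Hc] := EVT_max hh cP; exists `|w 1%N c - u0| => t.
  have -> : w 1%N t = w 1%N (clamp (- h) h t).
    by rewrite /w /= /T (clamp_id (t := clamp _ _ _))// clamp_in.
  by apply: Hc; rewrite in_itv /= clamp_in.
have M0 : 0 <= M by exact: le_trans (w1 0).
have w0 k t : `|w k t - w 0%N t| <= M * 2.
  elim: k t => [|k IH] t; first by rewrite subrr normr0 mulr_ge0.
  rewrite (le_trans (ler_distD (w 1%N t) _ _))//.
  have := T_dist K0 (cw k) (cw 0%N) IH t; have := w1 t.
  rewrite -[T (w k) t]/(w k.+1 t) -[T (w 0%N) t]/(w 1%N t); lra.
have wn n k t : `|w (n + k)%N t - w n t| <= M * 2 / 2 ^+ n.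
  elim: n t => [|n IH] t; first by rewrite expr0 divr1; exact: w0.
  have := T_dist K0 (cw (n + k)%N) (cw n) IH t.
  by rewrite exprSr invfM mulrA.
have small e : 0 < e -> exists n, M * 2 / 2 ^+ n < e.
  move=> e0; have := @cvg_geometric R (M * 2) 2^-1.
  rewrite ger0_norm// invf_lt1// ltr1n => /(_ isT)/cvgrPdist_lt/(_ _ e0)[n _ /(_ n)].
  rewrite /= leqnn => /(_ isT); rewrite sub0r normrN /geometric /= exprVn => H.
  by exists n; apply: le_lt_trans H; exact: ler_norm.
have cvgw t : cvg (w n t @[n --> \oo]).
  apply/cauchy_cvgP; apply: cauchy_exP => e e0.
  have [n ne] := small e e0; exists (w n t); exists n => // k /= nk.
  by rewrite -ball_normE /= distrC (le_lt_trans _ ne)// -(subnKC nk).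
pose v t := lim (w n t @[n --> \oo]).
have vw n t : `|v t - w n t| <= M * 2 / 2 ^+ n.
  apply/ler_addgt0Pl => e e0.
  have /cvgrPdist_le /(_ _ e0) [N _ /(_ (N + n)%N)] := cvgw t.
  rewrite /= leq_addr => /(_ isT) H.
  rewrite (le_trans (ler_distD (w (N + n)%N t) _ _))// lerD//.
  by rewrite addnC.
have cv : continuous v.
  move=> t; apply/cvgrPdist_lt => e e0.
  have e3 : 0 < e / 3 by rewrite divr_gt0.
  have [n ne] := small _ e3.
  have /cvgrPdist_lt /(_ _ e3) := cw n t.
  apply: filterS => s ws.
  have := vw n t; have := vw n s.
  have := ler_distD (w n t) (v t) (v s).
  have := ler_distD (w n s) (w n t) (v s).
  rewrite (distrC (w n s) (v s)); lra.
have [P0 dP] := primitiveP h (cF cv).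
have vT t : `|t| <= h -> v t = u0 + primitive h (fun s => F s (v s)) t.
  move=> th; apply/eqP; rewrite -subr_eq0 -normr_le0; apply/ler_addgt0Pl => e e0.
  have [n ne] := small e e0.
  have H1 := vw n.+1 t; have H2 := T_dist K0 cv (cw n) (vw n) t.
  move: H2; rewrite {1}/T clamp_id -?ler_norml// -[T (w n) t]/(w n.+1 t) => H2.
  rewrite addr0 (le_trans (ler_distD (w n.+1 t) _ _))//.
  rewrite [X in _ + X]distrC; move: H1; rewrite exprSr invfM mulrA; lra.
(* The limit [v] is frozen beyond [-h, h] and may lack a two-sided derivative at the ends; the
   unclamped primitive has one. *)
exists (fun t => u0 + primitive h (fun s => F s (v s)) t); split.
  by rewrite P0 addr0.
move=> t th; rewrite -vT//.
have := @is_deriveD _ _ _ (cst u0) (primitive h (fun s => F s (v s))) t 1 _ _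
    (is_derive_cst _ _ _) (dP t th).
by rewrite add0r.
Qed.

End picard.

(** * Hadamard's lemma and its converse *)

Section compact_uniform.
Context {R : realType}.

(** The tube lemma: continuity at each point of the compact segment over [q0] becomes closeness
    uniform in [t]. *)
Lemma compact_uniform (T : topologicalType) (V : normedModType R)
    (G : R -> T -> V) (a b : R) (q0 : T) :
  (forall t, a <= t <= b -> {for (t, q0), continuous (fun z : R * T => G z.1 z.2)}) ->
  forall e, 0 < e -> \forall q \near q0, forall t, a <= t <= b -> `|G t q0 - G t q| < e.
Proof.
move=> cG e e0.
have e2 : 0 < e / 2 by rewrite divr_gt0.
have := (compact_near_coveringP _).1 (@segment_compact R a b) T (nbhs q0)
  (fun q t => `|G t q0 - G t q| < e) _.
move=> H; have {}H : \forall q \near q0, `[a, b] `<=` (fun t => `|G t q0 - G t q| < e).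
  apply: H => t; rewrite /= in_itv /= => tab.
  have /cvgrPdist_lt /(_ _ e2) [[A B] /= [At Bq] AB] := cG t tab.
  exists (A, B) => // -[t' q] /= [At' Bq'].
  have H1 := AB (t', q0) (conj At' (nbhs_singleton Bq)).
  have H2 := AB (t', q) (conj At' Bq').
  rewrite (le_lt_trans (ler_distD (G t q0) _ _))// (splitr e) ltrD//.
  by rewrite distrC.
by apply: filterS H => q H t tab; apply: H; rewrite /= in_itv.
Qed.

End compact_uniform.

Section mulmx_analysis.
Context {R : realType}.

Lemma is_derive_mulmxl (V : normedModType R) p q r (A : 'M[R]_(p, q))
    (f : V -> 'M[R]_(q, r)) x v df :
  is_derive x v f df -> is_derive x v (fun s => A *m f s) (A *m df).
Proof.
move=> /is_derive_mxP dfx; apply/is_derive_mxP => i j.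
under eq_fun do rewrite mxE.
have := @is_derive_sum _ _ _ q (fun k s => A i k * f s k j) x v (fun k => A i k * df k j).
rewrite mxE fct_sumE; exact.
Qed.

Lemma cvg_mulmx (T : Type) (F : set_system T) p q r (f : T -> 'M[R]_(p, q))
    (g : T -> 'M[R]_(q, r)) (A : 'M[R]_(p, q)) (B : 'M[R]_(q, r)) : Filter F ->
  f x @[x --> F] --> A -> g x @[x --> F] --> B ->
  f x *m g x @[x --> F] --> A *m B.
Proof.
move=> FF /cvg_mxP fA /cvg_mxP gB; apply/cvg_mxP => i j.
rewrite mxE; under eq_fun do rewrite mxE.
apply: cvg_big => [|k _]; first exact: add_continuous.
exact: cvgM.
Qed.

Lemma for_continuous_mxP (T : topologicalType) p q (f : T -> 'M[R]_(p, q)) x :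
  {for x, continuous f} <->
  forall i j, {for x, continuous (fun y => f y i j)}.
Proof. exact: cvg_mxP. Qed.

Lemma for_continuousD (T : topologicalType) (W : normedModType R) (f g : T -> W) x :
  {for x, continuous f} -> {for x, continuous g} ->
  {for x, continuous (fun y => f y + g y)}.
Proof. by move=> cf cg; exact: cvgD. Qed.

Lemma for_continuous_mulmx (T : topologicalType) p q r (f : T -> 'M[R]_(p, q))
    (g : T -> 'M[R]_(q, r)) x :
  {for x, continuous f} -> {for x, continuous g} ->
  {for x, continuous (fun y => f y *m g y)}.
Proof. by move=> cf cg; exact: cvg_mulmx. Qed.

End mulmx_analysis.

Section jacobian_rows.
Context {R : realType} {n l : nat}.
Implicit Types (f : 'rV[R]_n -> 'rV[R]_l) (U : set 'rV[R]_n).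

(* Agrees with [jacobian] where [f] is differentiable; defined from directional
   derivatives so that [Ck_on] applies to it directly. *)
Definition Jac f x : 'M[R]_(n, l) := \matrix_(i, j) 'D_(delta_mx 0 i) f x 0 j.

Lemma row_Jac f x i : row i (Jac f x) = 'D_(delta_mx 0 i) f x.
Proof. by apply/rowP => j; rewrite !mxE. Qed.

Lemma mul_Jac f x v : differentiable f x -> v *m Jac f x = 'D_v f x.
Proof.
move=> df; rewrite mulmx_sum_row [RHS]derive_sum_basis//.
by apply: eq_bigr => i _; rewrite row_Jac.
Qed.

Lemma Jac_jacobian f x : differentiable f x -> Jac f x = jacobian f x.
Proof.
by move=> df; apply/row_matrixP => i; rewrite row_Jac rowE deriveEjacobian.
Qed.

Lemma Ck_Jac k U f : open U -> Ck_on k.+1 U f -> Ck_on k U (Jac f).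
Proof.
move=> oU [_ cf]; apply/(Ck_mx _ _ oU) => i j.
under eq_fun do rewrite mxE.
by have /(Ck_mx _ _ oU) := cf (delta_mx 0 i); exact.
Qed.

End jacobian_rows.

Section hadamard.
Context {R : realType} {n l : nat}.
Variables (U : set 'rV[R]_n) (f : 'rV[R]_n -> 'rV[R]_l).

(** Convexity of [U], in the form needed to integrate along segments. *)
Definition segment_closed :=
  forall x y t, U x -> U y -> 0 <= t <= 1 -> U (x + t *: (y - x)).

(* int_0^1 Jac f (x + t (y - x)) dt; clamping [t] makes the integrand continuous on
   the whole line, as [primitive] requires. *)
Definition hadamard_mx (x y : 'rV[R]_n) : 'M[R]_(n, l) :=
  primitive 1 (fun t => Jac f (x + clamp 0 1 t *: (y - x))) 1.

Hypotheses (oU : open U) (sU : segment_closed) (cf : Ck_on 1 U f).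

Let cJ x : U x -> {for x, continuous (Jac f)}.
Proof. by have /= := Ck_Jac oU cf; exact. Qed.

Let cJ_path x y : U x -> U y ->
  continuous (fun t : R => Jac f (x + clamp 0 1 t *: (y - x))).
Proof.
move=> Ux Uy t; apply: (@continuous_comp _ _ _ (fun t : R => x + clamp 0 1 t *: (y - x))).
  by apply: cvgD; [exact: cvg_cst|apply: cvgZr_tmp; exact: clamp_continuous].
by apply: cJ; apply: sU => //; exact: clamp_in.
Qed.

(** Along the segment, [f] and the primitive of [Jac f] multiplied by [y - x] have the same
    derivative; the mean value theorem compares them entry by entry between times 0 and 1. *)
Lemma hadamard x y : U x -> U y -> f y - f x = (y - x) *m hadamard_mx x y.
Proof.
move=> Ux Uy; rewrite /hadamard_mx; set g := fun t : R => Jac f _.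
have [P0 dP] := primitiveP 1 (cJ_path Ux Uy : continuous g).
apply/rowP => j.
pose r (t : R) := f (x + t *: (y - x)) 0 j - ((y - x) *m primitive 1 g t) 0 j.
have [t t01|c _] := @MVT0 R r (fun=> 0) 1 ltr01; last first.
  rewrite mulr0 => /eqP; rewrite subr_eq0 /r P0 mulmx0 scale0r scale1r addr0 subrKC.
  rewrite (_ : (0 : 'rV[R]_l) 0 j = 0) ?subr0; last by rewrite mxE.
  by rewrite subr_eq addrC -subr_eq => /eqP <-; rewrite !mxE.
have Ut := sU Ux Uy t01.
have dft := (cf.1 _ Ut).
have /is_derive_mxP/(_ 0 j) d1 := is_derive_line (@diff_derivable _ _ _ _ _ (y - x) dft).
have t1 : `|t| <= 1 by case/andP: t01 => t0 t1; rewrite ger0_norm.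
have /is_derive_mxP/(_ 0 j) d2 := is_derive_mulmxl (y - x) (dP t t1).
have := is_deriveB d1 d2.
by rewrite /g clamp_id// mul_Jac// subrr.
Qed.

Lemma hadamard_mx_diag x : hadamard_mx x x = Jac f x.
Proof.
rewrite /hadamard_mx subrr; under eq_fun do rewrite scaler0 addr0.
have cc : continuous (fun _ : R => Jac f x) by move=> ?; exact: cvg_cst.
have dJ (t : R) : `|t| <= 1 -> is_derive t 1 (fun t : R => t *: Jac f x) (Jac f x).
  move=> _; apply/is_derive_mxP => i j; under eq_fun do rewrite mxE.
  have := @is_deriveM _ _ id (cst (Jac f x i j)) t (1 : R) _ _ (is_derive_id _ _)
      (is_derive_cst _ _ _).
  by rewrite scaler0 add0r [_ *: 1]mulr1.
have n1 : `|1 : R| <= 1 by rewrite normr1.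
by rewrite -[LHS]add0r -(scale0r (Jac f x)) -(primitive_unique cc dJ n1) scale1r.
Qed.

Lemma hadamard_mx_le (C : R) x y : U x -> U y ->
  (forall z, U z -> `|Jac f z| <= C) -> `|hadamard_mx x y| <= C.
Proof.
move=> Ux Uy JC; rewrite /hadamard_mx; set g := fun t : R => Jac f _.
have [P0 dP] := primitiveP 1 (cJ_path Ux Uy : continuous g).
have := @MVI R n l (primitive 1 g) g 1 C dP _ 1.
rewrite P0 subr0 normr1 mulr1; apply=> // t _.
by apply: JC; apply: sU => //; exact: clamp_in.
Qed.

(** By compactness of [0, 1] the integrands are uniformly close for [q] near [q0], and integration
    preserves the bound. *)
Lemma hadamard_mx_continuous (T : topologicalType) (a b : T -> 'rV[R]_n) q0 :
  {for q0, continuous a} -> {for q0, continuous b} ->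
  (\forall q \near q0, U (a q) /\ U (b q)) ->
  {for q0, continuous (fun q => hadamard_mx (a q) (b q))}.
Proof.
move=> ca cb Uab; have [Ua Ub] := nbhs_singleton Uab.
apply/cvgrPdist_le => e e0.
have cJt t : 0 <= t <= 1 -> {for (t, q0), continuous
    (fun z : R * T => Jac f (a z.2 + z.1 *: (b z.2 - a z.2)))}.
  move=> t01.
  apply: (@continuous_comp _ _ _ (fun z : R * T => a z.2 + z.1 *: (b z.2 - a z.2)) (Jac f));
      last first.
    by apply: cJ; exact: sU.
  have ca2 : {for (t, q0), continuous (fun z : R * T => a z.2)}.
    by apply: (@continuous_comp _ _ _ snd a) => //; exact: cvg_snd.
  have cb2 : {for (t, q0), continuous (fun z : R * T => b z.2)}.
    by apply: (@continuous_comp _ _ _ snd b) => //; exact: cvg_snd.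
  apply: cvgD => //; apply: cvgZ; first exact: cvg_fst.
  exact: cvgB.
have H := @compact_uniform R T _ (fun t q => Jac f (a q + t *: (b q - a q))) 0 1 q0 cJt e e0.
apply: filterS (filterI Uab H) => q [[Uaq Ubq] {}H].
have := @primitive_dist R n l 1 _ _ e (cJ_path Ua Ub) (cJ_path Uaq Ubq) _ 1.
rewrite normr1 mulr1; apply=> // t _; apply/ltW/H; exact: clamp_in.
Qed.

End hadamard.

Section hadamard_converse.
Context {R : realType} {n l : nat}.

(** Carathéodory's criterion. Both solutions of differential equations and local inverses are shown
    differentiable through it, as their increments come already factored. *)
Lemma differentiable_factor (f : 'rV[R]_n -> 'rV[R]_l)
    (G : 'rV[R]_n -> 'M[R]_(n, l)) x :
  (\forall y \near x, f y - f x = (y - x) *m G y) ->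
  {for x, continuous G} -> differentiable f x /\ Jac f x = G x.
Proof.
move=> fG cG.
pose L (v : 'rV[R]_n) : 'rV[R]_l := v *m G x.
have L_lin : linear L by move=> a u v; rewrite /L mulmxDl -scalemxAl.
pose lL := GRing.isLinear.Build _ _ _ _ L L_lin.
pose dL : {linear 'rV[R]_n -> 'rV[R]_l} := HB.pack L lL.
have cL : continuous dL.
  move=> v; apply: (@cvg_mulmx _ _ (nbhs v) _ _ _ id (fun=> G x) v (G x)).
    exact: cvg_id.
  exact: cvg_cst.
have E : f \o shift x = cst (f x) + dL +o_ (0 : 'rV[R]_n) id.
  apply/eqaddoP => e e0.
  (* The factor [n] is the cost of [mulmx_norm_le]; adding 1 keeps the divisor positive for
     [n = 0]. *)
  have n0 : 0 < n%:R + 1 :> R by rewrite ltr_wpDl.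
  have en : 0 < e / (n%:R + 1) by rewrite divr_gt0.
  move/cvgrPdist_le : cG => /(_ _ en) cG.
  have H : \forall y \near (0 : 'rV[R]_n), f (y + x) - f x = y *m G (y + x) /\
      `|G x - G (y + x)| <= e / (n%:R + 1).
    have H0 : \forall y \near x, f y - f x = (y - x) *m G y /\
      `|G x - G y| <= e / (n%:R + 1) by exact: filterI fG cG.
    move: H0; rewrite (near_shift (0 : 'rV[R]_n) x) subr0.
    by apply: filterS => y /=; rewrite addrK.
  apply: filterS H => y [fy Gy] /=.
  rewrite !fctE /= opprD addrA fy -mulmxBr.
  rewrite (le_trans (mulmx_norm_le _ (ltW en) _))//.
    move=> i j; apply: le_trans (mx_entry_le_norm _ i j) _.
    by rewrite distrC.
  rewrite ler_wpM2r// mulrCA ger_pMr//.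
  by rewrite ler_pdivrMr// mul1r lerDl.
have dE : 'd f x = dL :> (_ -> _) by exact: diff_unique.
have df : differentiable f x by apply/diff_locallyP; rewrite dE.
split=> //; apply/row_matrixP => i.
by rewrite row_Jac deriveE// dE rowE.
Qed.

End hadamard_converse.

(** * Smooth dependence of flows on initial data *)

Section cube.
Context {R : realType} {n : nat}.
Implicit Types (z : 'rV[R]_n) (r s : R).

Lemma mx_norm_ltP p q (v : 'M[R]_(p, q)) (c : R) : 0 < c ->
  (forall i j, `|v i j| < c) -> `|v| < c.
Proof.
move=> c0 vc; rewrite [`|v|]mx_normrE.
by apply: bigmax_lt => // -[i j] _; exact: vc.
Qed.

(** For the largest-entry norm this ball is a product of intervals, hence stable under resetting one
    coordinate; this allows a coordinate to be used as time. *)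
Definition cube r : set 'rV[R]_n := [set z | `|z| < r].

Lemma cubeE r : cube r = ball 0 r.
Proof. by rewrite -ball_normE; apply/seteqP; split=> z /=; rewrite sub0r normrN. Qed.

Lemma open_cube r : open (cube r).
Proof. by rewrite cubeE; exact: ball_open. Qed.

Lemma nbhs_cube r z : cube r z -> nbhs z (cube r).
Proof. by move=> rz; apply: open_nbhs_nbhs; split=> //; exact: open_cube. Qed.

Lemma cube_le r r' z : r <= r' -> cube r z -> cube r' z.
Proof. by move=> rr' /= /lt_le_trans; apply. Qed.

Lemma cube_between r z : cube r z -> exists r', [/\ 0 < r', r' < r & cube r' z].
Proof.
rewrite /cube /= => zr; exists ((`|z| + r) / 2); have := normr_ge0 z.
by move=> z0; split; rewrite /=; lra.
Qed.

Lemma segment_closed_ball (c : 'rV[R]_n) r : segment_closed [set z | `|z - c| < r].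
Proof.
move=> x y t /= xr yr /andP[t0 t1].
have -> : x + t *: (y - x) - c = (1 - t) *: (x - c) + t *: (y - c).
  by apply/rowP => i; rewrite !mxE; ring.
apply: le_lt_trans (ler_normD _ _) _; rewrite !normrZ !ger0_norm ?subr_ge0//.
have [->|tn0] := eqVneq t 0; first by rewrite subr0 mul1r mul0r addr0.
have tp : 0 < t by rewrite lt_def tn0.
have := ler_wpM2l (_ : 0 <= 1 - t) (ltW xr); rewrite subr_ge0 => /(_ t1).
have : t * `|y - c| < t * r by rewrite ltr_pM2l.
lra.
Qed.

Lemma segment_closed_cube r : segment_closed (cube r).
Proof.
move=> x y t xr yr t01.
have := @segment_closed_ball 0 r x y t; rewrite /= !subr0; exact.
Qed.

End cube.

Section set_coord.
Context {R : realType} {n : nat} (tau : 'I_n).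
Implicit Types (z : 'rV[R]_n) (r s : R).

(* The differential equations below have the coordinate [tau] as time variable and
   the other coordinates as parameters; [set_coord z] is the time line through [z]. *)
Definition set_coord z s := z + (s - z 0 tau) *: (delta_mx 0 tau : 'rV[R]_n).

Lemma set_coordE z s i : set_coord z s 0 i = if i == tau then s else z 0 i.
Proof.
rewrite !mxE /=; case: eqP => [->|_]; last by rewrite mulr0 addr0.
by rewrite mulr1 subrKC.
Qed.

Lemma set_coord_tau z s : set_coord z s 0 tau = s.
Proof. by rewrite set_coordE eqxx. Qed.

Lemma set_coord_id z : set_coord z (z 0 tau) = z.
Proof. by rewrite /set_coord subrr scale0r addr0. Qed.

Lemma set_coord_set z s s' : set_coord (set_coord z s) s' = set_coord z s'.
Proof. by apply/rowP => i; rewrite !set_coordE; case: eqP. Qed.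

Lemma cube_coord r z i : cube r z -> `|z 0 i| < r.
Proof. by apply: le_lt_trans; exact: mx_entry_le_norm. Qed.

Lemma cube_set_coord r z s : cube r z -> `|s| < r -> cube r (set_coord z s).
Proof.
move=> zr sr; apply: mx_norm_ltP => [|i j]; first exact: le_lt_trans sr.
by rewrite (ord1 i) set_coordE; case: eqP => // _; exact: cube_coord.
Qed.

Lemma set_coord_continuous2 z s : {for (s, z), continuous
  (fun x : R * 'rV[R]_n => set_coord x.2 x.1)}.
Proof.
apply: cvgD; first exact: cvg_snd.
apply: cvgZr_tmp; apply: cvgB; first exact: cvg_fst.
apply: (@continuous_comp _ _ _ snd (fun M : 'rV[R]_n => M 0 tau)); first exact: cvg_snd.
exact: coord_continuous.
Qed.

Lemma set_coord_continuous z : continuous (set_coord z).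
Proof.
move=> s; apply: cvgD; first exact: cvg_cst.
by apply: cvgZr_tmp; apply: cvgB; [exact: cvg_id|exact: cvg_cst].
Qed.

Lemma set_coord_continuousl s : continuous (fun z => set_coord z s).
Proof.
move=> z; apply: (@cvgD _ _ _ (nbhs z) _ id); first exact: cvg_id.
apply: cvgZr_tmp; apply: cvgB; first exact: cvg_cst.
exact: coord_continuous.
Qed.

Lemma set_coord_line_continuous z0 : continuous (fun z => set_coord z0 (z 0 tau)).
Proof.
move=> z; apply: (@continuous_comp _ _ _ (fun z => z 0 tau) (set_coord z0)).
  exact: coord_continuous.
exact: set_coord_continuous.
Qed.

(** The bridge between directional derivatives on the cube and ordinary differential equations in
    time: the two difference quotients are the same function. *)
Lemma is_derive_set_coord (W : normedModType R) (y : 'rV[R]_n -> W) z s D :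
  is_derive (set_coord z s) (delta_mx 0 tau : 'rV[R]_n) y D <->
  is_derive s 1 (fun t => y (set_coord z t)) D.
Proof.
have E : (fun h : R => h^-1 *: (y (set_coord z (h *: (1 : R^o) + s)) - y (set_coord z s))) =
   (fun h : R => h^-1 *: (y (h *: (delta_mx 0 tau : 'rV[R]_n) + set_coord z s) - y
       (set_coord z s))).
  apply/funext => h; congr (_ *: (y _ - _)); rewrite /set_coord [h *: 1]mulr1.
  by rewrite addrCA -addrA scalerDl.
by split=> -[dy yD]; apply: DeriveDef; move: dy yD; rewrite /derivable /derive /= E.
Qed.

Lemma is_derive_line_continuous (W : normedModType R) (y : 'rV[R]_n -> W) z D :
  is_derive z (delta_mx 0 tau : 'rV[R]_n) y D ->
  {for z, continuous (fun w : 'rV[R]_n => y (set_coord z (w 0 tau)))}.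
Proof.
move=> dy.
apply: (@continuous_comp _ _ _ (fun w : 'rV[R]_n => w 0 tau) (fun s => y (set_coord z s))).
  exact: coord_continuous.
apply: (@is_derive_continuous R _ (fun s => y (set_coord z s)) (z 0 tau) D).
by apply/is_derive_set_coord; rewrite set_coord_id.
Qed.

End set_coord.

Section ode_cube.
Context {R : realType} {n : nat} (tau : 'I_n).
Local Notation e_tau := (delta_mx 0 tau : 'rV[R]_n).

(** Picard's theorem on each time line separately; regularity across time lines is obtained
    afterwards. *)
Lemma ode_exists p m (a : 'rV[R]_n -> 'M[R]_(p, m) -> 'M[R]_(p, m))
    (b : 'rV[R]_n -> 'M[R]_(p, m)) (r r' K : R) :
  0 < r' -> r' < r -> 0 <= K -> K * r' <= 2^-1 ->
  (forall z u v, cube r z -> `|a z u - a z v| <= K * `|u - v|) ->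
  (forall (c : R -> 'rV[R]_n) (u : R -> 'M[R]_(p, m)), continuous c ->
     continuous u -> (forall t, cube r (c t)) -> continuous (fun t => a (c t) (u t))) ->
  exists y : 'rV[R]_n -> 'M[R]_(p, m),
    (forall z, cube r' z -> is_derive z e_tau y (a z (y z))) /\
    (forall z, cube r' z -> z 0 tau = 0 -> y z = b z).
Proof.
move=> r'0 r'r K0 Kr' alip acont.
pose F z t u := a (set_coord tau z (clamp (- r') r' t)) u.
have rr' : - r' <= r' by rewrite ge0_cp// ltW.
have inr z t : cube r' z -> cube r (set_coord tau z (clamp (- r') r' t)).
  move=> zr'; apply: cube_set_coord; first by apply: cube_le zr'; exact: ltW.
  by apply: le_lt_trans r'r; rewrite ler_norml clamp_in.
have ex z : cube r' z -> exists u : R -> 'M[R]_(p, m), u 0 = b z /\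
    forall t : R, `|t| <= r' -> is_derive t 1 u (F z t (u t)).
  move=> zr'; apply: (@picard R p m (F z) K r' (b z)) => //; first exact: ltW.
    move=> u cu; apply: acont => // [t|t]; last exact: inr.
    apply: (@continuous_comp _ _ _ (clamp (- r') r') (set_coord tau z)).
      exact: clamp_continuous.
    exact: set_coord_continuous.
  by move=> t u v; apply: alip; exact: inr.
pose sol z : R -> 'M[R]_(p, m) := get [set u | u 0 = b z /\
    forall t : R, `|t| <= r' -> is_derive t 1 u (F z t (u t))].
(* Indexing the solution by the point at time 0 makes all points of a time line share one
   solution. *)
exists (fun z => sol (set_coord tau z 0) (z 0 tau)); split=> z zr'; last first.
  move=> z0; have [s0 _] := getPex (ex z zr').
  have Ez : set_coord tau z 0 = z by rewrite -[RHS](set_coord_id tau z) z0.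
  by rewrite Ez z0.
have z0r' : cube r' (set_coord tau z 0) by apply: cube_set_coord; rewrite ?normr0.
have [_ ds] := getPex (ex _ z0r').
have zt := cube_coord tau zr'.
rewrite -{1}(set_coord_id tau z); apply/is_derive_set_coord.
have -> : (fun t => sol (set_coord tau (set_coord tau z t) 0) (set_coord tau z t 0 tau))
  = sol (set_coord tau z 0) by apply/funext => t; rewrite set_coord_set set_coord_tau.
have := ds _ (ltW zt); rewrite /F set_coord_set clamp_id ?set_coord_id//.
by rewrite -ler_norml ltW.
Qed.

(** [short_gronwall] with zero source and zero initial value, on the time line through [z]. *)
Lemma ode_unique p m (A : 'rV[R]_n -> 'M[R]_m) (d : 'rV[R]_n -> 'M[R]_(p, m))
    (r C : R) (z : 'rV[R]_n) : 0 <= C -> m%:R * C * r <= 2^-1 -> cube r z ->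
  (forall s, `|s| < r -> `|A (set_coord tau z s)| <= C) ->
  (forall s, `|s| < r -> is_derive (set_coord tau z s) e_tau d
    (d (set_coord tau z s) *m A (set_coord tau z s))) ->
  d (set_coord tau z 0) = 0 -> d z = 0.
Proof.
move=> C0 Cr zr AC dd d0; have zt := cube_coord tau zr.
apply/eqP; rewrite -normr_le0 -(set_coord_id tau z).
have /= := @short_gronwall R p m (fun t => d (set_coord tau z t))
  (fun t => d (set_coord tau z t) *m A (set_coord tau z t)) `|z 0 tau| (m%:R * C) 0 _ _ _ _ _
      (z 0 tau).
rewrite d0 normr0 mulr0 addr0 mulr0; apply=> //.
- by rewrite mulr_ge0.
- by apply: le_trans Cr; rewrite ler_wpM2l ?mulr_ge0// ltW.
- by move=> t tz; apply/is_derive_set_coord; apply: dd; exact: le_lt_trans zt.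
move=> t tz; rewrite addr0; apply: mulmx_norm_le => // i j.
apply: le_trans (mx_entry_le_norm _ i j) _; apply: AC; exact: le_lt_trans zt.
Qed.

(** Solutions on the time lines of [z] and [z0] are compared by [short_gronwall]. The source is the
    change of [a] when only the point moves and the solution value on the line of [z0] is kept;
    [compact_uniform] makes it small for all times. *)
Lemma ode_continuous p m (a : 'rV[R]_n -> 'M[R]_(p, m) -> 'M[R]_(p, m))
    (y b : 'rV[R]_n -> 'M[R]_(p, m)) (r K : R) : 0 <= K -> K * r <= 2^-1 ->
  (forall z, cube r z -> is_derive z e_tau y (a z (y z))) ->
  (forall z, cube r z -> z 0 tau = 0 -> y z = b z) ->
  (forall z, cube r z -> {for z, continuous b}) ->
  (forall z w, cube r z -> cube r w -> `|a z (y z) - a z (y w)| <= K * `|y z - y w|) ->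
  (forall z, cube r z ->
    {for z, continuous (fun w : 'rV[R]_n => a w (y (set_coord tau z (w 0 tau))))}) ->
  forall z, cube r z -> {for z, continuous y}.
Proof.
move=> K0 Kr dy yb cb alip ca z0 z0r.
have z0t := cube_coord tau z0r.
(* Strictly between the two: [-h, h] stays inside the cube and contains the time of every [z] near
   [z0]. *)
pose h := (`|z0 0 tau| + r) / 2.
have h0 : 0 < h by rewrite /h; have := normr_ge0 (z0 0 tau); lra.
have hr : h < r by rewrite /h; lra.
have z0h : `|z0 0 tau| < h by rewrite /h; lra.
have cl : {for z0, continuous (fun z : 'rV[R]_n => y (set_coord tau z0 (z 0 tau)))}.
  by apply: is_derive_line_continuous; exact: dy.
have c0 : {for z0, continuous (fun z : 'rV[R]_n => y (set_coord tau z 0))}.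
  have c0r z : cube r z -> cube r (set_coord tau z 0).
    by move=> zr; apply: cube_set_coord; rewrite ?normr0// (le_lt_trans _ z0t).
  have cs : {for z0, continuous (fun z : 'rV[R]_n => b (set_coord tau z 0))}.
    apply: (@continuous_comp _ _ _ (fun z : 'rV[R]_n => set_coord tau z 0) b); last exact/cb/c0r.
    exact: set_coord_continuousl.
  have E : \forall z \near z0, b (set_coord tau z 0) = y (set_coord tau z 0).
    by apply: filterS (nbhs_cube z0r) => z zr; rewrite yb ?set_coord_tau//; exact: c0r.
  rewrite /prop_for /continuous_at -(nbhs_singleton E).
  by move: cs; apply: cvg_trans; exact: (near_eq_cvg E).
apply/for_continuousP => e e0.
(* The budget is e/8 along the time line of [z0] plus 2 (e/8 + h e/(8h)) across it. *)
have e8 : 0 < e / 8 by rewrite divr_gt0.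
have eh : 0 < e / (8 * h) by rewrite divr_gt0// mulr_gt0.
pose G t z := a (set_coord tau z t) (y (set_coord tau z0 t)).
have cG t : - h <= t <= h -> {for (t, z0), continuous (fun x : R * 'rV[R]_n => G x.1 x.2)}.
  rewrite -ler_norml => th.
  have zr : cube r (set_coord tau z0 t) by apply: cube_set_coord => //; exact: le_lt_trans hr.
  have -> : (fun x : R * 'rV[R]_n => G x.1 x.2) =
      (fun w => a w (y (set_coord tau (set_coord tau z0 t) (w 0 tau)))) \o
      (fun x : R * 'rV[R]_n => set_coord tau x.2 x.1).
    by apply/funext => x; rewrite /= set_coord_tau set_coord_set.
  apply: continuous_comp; first exact: set_coord_continuous2.
  exact: ca.
have HG := compact_uniform cG eh.
have Hc : nbhs z0 [set z : 'rV[R]_n | `|z 0 tau| < h].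
  have : {for z0, continuous (fun z : 'rV[R]_n => `|z 0 tau|)}.
    apply: (@continuous_comp _ _ _ (fun z : 'rV[R]_n => z 0 tau) Num.norm).
      exact: coord_continuous.
    exact: norm_continuous.
  by move=> /cvgr_lt; apply.
move/for_continuousP : cl => /(_ _ e8) cl; move/for_continuousP : c0 => /(_ _ e8) c0.
rewrite set_coord_id in cl.
apply: filterS (filterI (filterI (nbhs_cube z0r) Hc) (filterI (filterI cl c0) HG)).
move=> z [[zr zh] [[H1 H2] H3]].
have := @short_gronwall R p m
  (fun t => y (set_coord tau z t) - y (set_coord tau z0 t))
  (fun t => a (set_coord tau z t) (y (set_coord tau z t)) -
            a (set_coord tau z0 t) (y (set_coord tau z0 t))) h K (e / (8 * h)) _ _ _ _ _ (z 0 tau).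
rewrite set_coord_id (distrC (y (set_coord tau z 0))) => H.
have {}H : `|y z - y (set_coord tau z0 (z 0 tau))| <=
    2 * (`|y (set_coord tau z0 0) - y (set_coord tau z 0)| + h * (e / (8 * h))).
  apply: H => //.
  - exact: ltW.
  - by apply: le_trans Kr; rewrite ler_wpM2l// ltW.
  - move=> t th; have tr : `|t| < r by exact: le_lt_trans hr.
    by apply: is_deriveB; apply/is_derive_set_coord; apply: dy; exact: cube_set_coord.
  - move=> t th; have tr : `|t| < r by exact: le_lt_trans hr.
    rewrite (le_trans (ler_distD (a (set_coord tau z t) (y (set_coord tau z0 t))) _ _))//.
    rewrite lerD//; first by apply: alip; exact: cube_set_coord.
    by rewrite distrC ltW//; apply: H3; rewrite -ler_norml.
  - exact: ltW.
have E : h * (e / (8 * h)) = e / 8.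
  by field; rewrite gt_eqF.
rewrite E in H.
have := ler_distD (y (set_coord tau z0 (z 0 tau))) (y z0) (y z).
rewrite (distrC (y (set_coord tau z0 (z 0 tau))) (y z)); lra.
Qed.

End ode_cube.

Section ode_differentiable.
Context {R : realType} {n m : nat} (tau : 'I_n).
Local Notation e_tau := (delta_mx 0 tau : 'rV[R]_n).

Lemma difference_quotient_continuous p q (f : R -> 'M[R]_(p, q)) (t : R) D :
  is_derive t 1 f D ->
  {for t, continuous (fun s => if s == t then D else (s - t)^-1 *: (f s - f t))}.
Proof.
move=> [dft fD]; apply/for_continuousP => e e0; rewrite eqxx.
move: dft; rewrite /derivable => /cvgrPdist_le /(_ _ e0).
rewrite -[lim _]/('D_1 f t) fD => -[d /= d0 dH].
exists d => // s /= st; case: eqP => [_|/eqP sn]; first by rewrite subrr normr0 ltW.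
have := dH (s - t); rewrite /= [_ *: 1]mulr1 subrK; apply; last by rewrite subr_eq0.
by rewrite /= sub0r normrN distrC.
Qed.

(* The difference between [y] and its values on the time line of [z0] satisfies
   exactly a linear equation (hypothesis on [g]), hence equals [(z - z') *m gamma z]
   with [gamma] the matrix solution of that equation; continuity of [gamma] then
   gives differentiability. *)
Lemma ode_differentiable (y g : 'rV[R]_n -> 'rV[R]_m) (A : 'rV[R]_n -> 'M[R]_m)
    (B B0 delta : 'rV[R]_n -> 'M[R]_(n, m)) (r r' C : R) (z0 : 'rV[R]_n) :
  0 < r' -> r' < r -> cube r' z0 -> 0 <= C -> m%:R * C * r <= 2^-1 ->
  (forall z, cube r z -> is_derive z e_tau y (g z)) ->
  (forall z, cube r z -> {for z, continuous A}) ->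
  (forall z, cube r z -> `|A z| <= C) ->
  (forall z, cube r z -> {for z, continuous B}) ->
  (forall z, cube r z -> {for z, continuous B0}) ->
  (forall z, cube r z -> let z' := set_coord tau z0 (z 0 tau) in
    g z - g z' = (y z - y z') *m A z + (z - z') *m B z) ->
  (forall z, cube r z -> z 0 tau = 0 -> let z' := set_coord tau z0 0 in
    y z - y z' = (z - z') *m B0 z) ->
  (forall s, `|s| < r' -> let z' := set_coord tau z0 s in
    is_derive z' e_tau delta (delta z' *m A z' + B z')) ->
  delta (set_coord tau z0 0) = B0 (set_coord tau z0 0) ->
  differentiable y z0 /\
  forall i, 'D_(delta_mx 0 i) y z0 = if i == tau then g z0 else row i (delta z0).
Proof.
move=> r'0 r'r z0r' C0 Cr dy cA AC cB cB0 gE yE ddelta delta0.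
have Cr' : m%:R * C * r' <= 2^-1.
  by apply: le_trans Cr; rewrite ler_wpM2l ?mulr_ge0// ltW.
have mC0 : 0 <= m%:R * C by rewrite mulr_ge0.
have inr (z : 'rV[R]_n) : cube r' z -> cube r z by apply: cube_le; exact: ltW.
have AC' z i j : cube r z -> `|A z i j| <= C.
  by move=> zr; apply: le_trans (mx_entry_le_norm _ i j) (AC z zr).
have [] := @ode_exists R n tau n m (fun z u => u *m A z + B z) B0 r r' (m%:R * C) r'0 r'r mC0 Cr'.
- move=> z u v zr; rewrite opprD addrACA subrr addr0 -mulmxBl.
  by apply: mulmx_norm_le => // i j; exact: AC'.
- move=> c u cc cu cr t; apply: cvgD; last exact: (continuous_comp (cc t) (cB _ (cr t))).
  by apply: cvg_mulmx; [exact: cu|exact: (continuous_comp (cc t) (cA _ (cr t)))].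
move=> gamma [dgamma gamma0].
have cgamma : forall z, cube r' z -> {for z, continuous gamma}.
  apply: (@ode_continuous R n tau n m (fun z u => u *m A z + B z) gamma B0 r' (m%:R * C) mC0 Cr'
    dgamma gamma0).
  - by move=> z /inr; exact: cB0.
  - move=> z w zr wr; rewrite opprD addrACA subrr addr0 -mulmxBl.
    by apply: mulmx_norm_le => // i j; apply: AC'; exact: inr.
  - move=> z zr; apply: for_continuousD; last exact/cB/inr.
    apply: for_continuous_mulmx; last exact/cA/inr.
    by apply: is_derive_line_continuous; exact: dgamma.
have z0t := cube_coord tau z0r'.
have abs0 : `|0 : R| < r' by rewrite normr0.
(* [gamma] lives on the cube, which gives continuity, while [delta] is only known to solve the
   equation on the time line of [z0]; uniqueness there identifies them. *)
have gammaE : gamma z0 = delta z0.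
  apply/eqP; rewrite -subr_eq0; apply/eqP.
  apply: (@ode_unique R n tau n m A (fun z => gamma z - delta z) r' C) => //.
  - by move=> s sr; apply: AC; apply: inr; exact: cube_set_coord.
  - move=> s sr; have H1 := dgamma _ (cube_set_coord tau z0r' sr).
    have := is_deriveB H1 (ddelta s sr).
    by rewrite /= opprD addrACA subrr addr0 -mulmxBl.
  - by rewrite delta0 gamma0 ?subrr// ?set_coord_tau//; exact: cube_set_coord.
pose z' (z : 'rV[R]_n) := set_coord tau z0 (z 0 tau).
(* [z - z' z] is constant along time lines, so both sides solve the same linear equation with equal
   values at time 0. *)
have yz' z : cube r' z -> y z - y (z' z) = (z - z' z) *m gamma z.
  move=> zr; apply/eqP; rewrite -subr_eq0; apply/eqP.
  apply: (@ode_unique R n tau 1 m A (fun z => y z - y (z' z) - (z - z' z) *m gamma z) r' C z) => //.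
  - by move=> s sr; apply: AC; apply: inr; exact: cube_set_coord.
  - move=> s sr; apply/is_derive_set_coord.
    have zsr := cube_set_coord tau zr sr; have z0sr := cube_set_coord tau z0r' sr.
    have E t : set_coord tau z t - z' (set_coord tau z t) =
        set_coord tau z 0 - set_coord tau z0 0.
      apply/rowP => i; rewrite [LHS]mxE [RHS]mxE [X in _ + X = _]mxE [X in _ = _ + X]mxE.
      by rewrite /z' set_coord_tau !set_coordE; case: eqP; rewrite ?subrr.
    have -> : (fun t => y (set_coord tau z t) - y (z' (set_coord tau z t)) -
       (set_coord tau z t - z' (set_coord tau z t)) *m gamma (set_coord tau z t)) =
      (fun t => y (set_coord tau z t) - y (set_coord tau z0 t) -
       (set_coord tau z 0 - set_coord tau z0 0) *m gamma (set_coord tau z t)).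
      by apply/funext => t; rewrite E /z' set_coord_tau.
    have d1 : is_derive s 1 (fun t => y (set_coord tau z t)) (g (set_coord tau z s)).
      by apply/is_derive_set_coord; apply: dy; exact: inr.
    have d2 : is_derive s 1 (fun t => y (set_coord tau z0 t)) (g (set_coord tau z0 s)).
      by apply/is_derive_set_coord; apply: dy; exact: inr.
    have d3 : is_derive s 1 (fun t => gamma (set_coord tau z t))
        (gamma (set_coord tau z s) *m A (set_coord tau z s) + B (set_coord tau z s)).
      by apply/is_derive_set_coord; exact: dgamma.
    have := is_deriveB (is_deriveB d1 d2)
      (is_derive_mulmxl (set_coord tau z 0 - set_coord tau z0 0) d3).
    have := gE _ (inr _ zsr); rewrite /= set_coord_tau => ->.
    rewrite E /z' set_coord_tau.
    have -> : set_coord tau z s - set_coord tau z0 s = set_coord tau z 0 - set_coord tau z0 0.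
      by rewrite -(E s) /z' set_coord_tau.
    have alg (X : 'rV[R]_m) (v : 'rV[R]_n) g' (A' : 'M[R]_m) B' :
        X *m A' + v *m B' - v *m (g' *m A' + B') = (X - v *m g') *m A'.
      by rewrite mulmxDr opprD addrACA subrr addr0 mulmxA -mulmxBl.
    by rewrite alg; apply.
  - have zr0 := cube_set_coord tau zr abs0.
    have := yE _ (inr _ zr0); rewrite set_coord_tau => /(_ erefl) /= H.
    by rewrite /= /z' set_coord_tau H gamma0 ?set_coord_tau// subrr.
pose q s := if s == z0 0 tau then g z0 else (s - z0 0 tau)^-1 *:
  (y (set_coord tau z0 s) - y (set_coord tau z0 (z0 0 tau))).
have cq : {for z0 0 tau, continuous q}.
  apply: (@difference_quotient_continuous _ _ (fun s => y (set_coord tau z0 s))).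
  by apply/is_derive_set_coord; rewrite set_coord_id; exact/dy/inr.
(* The increment from [z0] splits into one along the time line and one across it. As [z - z' z] has
   zero time coordinate, the time row can hold the difference quotient [q] and the other rows those
   of [gamma]. *)
pose G (z : 'rV[R]_n) : 'M[R]_(n, m) :=
  \matrix_(i, j) if i == tau then q (z 0 tau) 0 j else gamma z i j.
have cG : {for z0, continuous G}.
  apply/for_continuous_mxP => i j.
  have -> : (fun z => G z i j) = fun z => if i == tau then q (z 0 tau) 0 j else gamma z i j.
    by apply/funext => z; rewrite mxE.
  case: (i == tau); last first.
    by apply: (@continuous_comp _ _ _ gamma (fun M : 'M[R]_(n, m) => M i j));
      [exact: cgamma|exact: coord_continuous].
  apply: (@continuous_comp _ _ _ (fun z : 'rV[R]_n => q (z 0 tau)) (fun M : 'rV[R]_m => M 0 j));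
      last exact: coord_continuous.
  by apply: (@continuous_comp _ _ _ (fun z : 'rV[R]_n => z 0 tau) q) => //; exact: coord_continuous.
have yG : \forall z \near z0, y z - y z0 = (z - z0) *m G z.
  apply: filterS (nbhs_cube z0r') => z zr.
  have -> : y z - y z0 = (z - z' z) *m gamma z + (z 0 tau - z0 0 tau) *: q (z 0 tau).
    rewrite -yz'// /q; case: eqP => [E|/eqP E].
      by rewrite E subrr scale0r addr0 /z' E set_coord_id.
    by rewrite scalerA mulfV ?subr_eq0// scale1r set_coord_id /z' addrA subrK.
  apply/rowP => j; rewrite [LHS]mxE [X in X + _]mxE [X in _ + X]mxE [RHS]mxE.
  transitivity (\sum_i ((z - z' z) 0 i * gamma z i j +
      if i == tau then (z 0 tau - z0 0 tau) * q (z 0 tau) 0 j else 0)).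
    by rewrite big_split /= -big_mkcond big_pred1_eq.
  apply: eq_bigr => i _; rewrite [G z i j]mxE.
  rewrite [(z - z' z) 0 i]mxE [(z - z0) 0 i]mxE [(- z' z) 0 i]mxE [(- z0) 0 i]mxE.
  rewrite [z' z 0 i]set_coordE; case: eqP => [->|_]; last by rewrite addr0.
  by rewrite subrr mul0r add0r.
have [dy0 JG] := differentiable_factor yG cG.
split=> // i; rewrite -row_Jac JG; apply/rowP => j; rewrite !mxE.
by case: eqP; rewrite /q ?eqxx// gammaE mxE.
Qed.

End ode_differentiable.

Section flow_smooth.
Context {R : realType} {n m : nat} (tau : 'I_n).
Local Notation e_tau := (delta_mx 0 tau : 'rV[R]_n).
Implicit Types y b beta : 'rV[R]_n -> 'rV[R]_m.

(** The projection of [z] onto the time line of [z0] at equal time. *)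
Let inline (z0 z : 'rV[R]_n) := set_coord tau z0 (z 0 tau).

Let hadamard_line_continuous l (f : 'rV[R]_n -> 'rV[R]_l) r z0 z :
  Ck_on 1 (cube r) f -> cube r z0 -> cube r z ->
  {for z, continuous (fun w : 'rV[R]_n => hadamard_mx f (inline z0 w) w)}.
Proof.
move=> cf z0r zr.
apply: (@hadamard_mx_continuous _ _ _ _ _ (@open_cube R n r)
    (@segment_closed_cube R n r) cf 'rV[R]_n (inline z0) id z).
- exact: set_coord_line_continuous.
- exact: cvg_id.
apply: filterS (nbhs_cube zr) => w wr; split=> //.
by apply: cube_set_coord => //; exact: cube_coord.
Qed.

Let hadamard_const_continuous l (f : 'rV[R]_n -> 'rV[R]_l) r z0 z :
  Ck_on 1 (cube r) f -> cube r z0 -> cube r z ->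
  {for z, continuous (fun w : 'rV[R]_n => hadamard_mx f z0 w)}.
Proof.
move=> cf z0r zr.
apply: (@hadamard_mx_continuous _ _ _ _ _ (@open_cube R n r)
    (@segment_closed_cube R n r) cf 'rV[R]_n (fun=> z0) id z).
- exact: (@cvg_cst _ _ _ (nbhs z)).
- exact: cvg_id.
by apply: filterS (nbhs_cube zr) => w wr.
Qed.

(* The derivatives of a solution satisfy affine equations with the same linear part
   [A], so the smallness condition on [r] is preserved by the induction on [k]. *)
Lemma affine_Ck k : forall r C (A : 'rV[R]_n -> 'M[R]_m) b beta y,
  0 <= C -> m%:R * C * r <= 2^-1 ->
  (forall z, cube r z -> `|A z| <= C) ->
  Ck_on k (cube r) A -> Ck_on k (cube r) b -> Ck_on k (cube r) beta ->
  (forall z, cube r z -> is_derive z e_tau y (y z *m A z + b z)) ->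
  (forall z, cube r z -> z 0 tau = 0 -> y z = beta z) ->
  Ck_on k (cube r) y.
Proof.
elim: k => [|k IH] r C A b beta y C0 Cr AC cA cb cbeta dy ybeta.
  apply: (@ode_continuous R n tau 1 m (fun z u => u *m A z + b z) y beta r (m%:R * C) _ Cr dy
    ybeta cbeta).
  - by rewrite mulr_ge0.
  - move=> z w zr wr; rewrite opprD addrACA subrr addr0 -mulmxBl.
    apply: mulmx_norm_le => // i j.
    by apply: le_trans (mx_entry_le_norm _ i j) (AC z zr).
  - move=> z zr; apply: for_continuousD; last exact: cb.
    apply: for_continuous_mulmx; last exact: cA.
    by apply: is_derive_line_continuous; exact: dy.
have cy : Ck_on k (cube r) y.
  by apply: (IH r C A b beta) => //; exact: Ck_pred.
have oQ := @open_cube R n r.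
have c1 l (f : 'rV[R]_n -> 'rV[R]_l) : Ck_on k.+1 (cube r) f -> Ck_on 1 (cube r) f.
  exact: Ck_le.
pose rowA a w := row a (A w).
have crowA a : Ck_on k.+1 (cube r) (rowA a).
  apply/(Ck_mx _ _ oQ) => i j; under eq_fun do rewrite mxE.
  by have /(Ck_mx _ _ oQ) := cA; exact.
(* The source term left by differentiating [y *m A + b] in the parameters, beside [Jac y *m A]. *)
pose B z : 'M[R]_(n, m) := Jac b z + \sum_a y z 0 a *: Jac (rowA a) z.
have cB : Ck_on k (cube r) B.
  apply: Ck_mxD => //; first exact: Ck_Jac.
  apply/(Ck_mx _ _ oQ) => i j; under eq_fun do rewrite summxE.
  apply: Ck_sum => // a _; under eq_fun do rewrite mxE.
  apply: CkM => //; first by have /(Ck_mx _ _ oQ) := cy; exact.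
  by have /(Ck_mx _ _ oQ) := Ck_Jac oQ (crowA a); exact.
(* [ode_exists] solves the differentiated equation only on a strictly smaller cube. *)
apply: Ck_local => z0 /cube_between[r' [r'0 r'r z0r']]; exists (cube r') => //.
have inr (z : 'rV[R]_n) : cube r' z -> cube r z by apply: cube_le; exact: ltW.
have Cr' : m%:R * C * r' <= 2^-1.
  by apply: le_trans Cr; rewrite ler_wpM2l ?mulr_ge0// ltW.
have mC0 : 0 <= m%:R * C by rewrite mulr_ge0.
have [] := @ode_exists R n tau n m (fun z u => u *m A z + B z) (Jac beta) r r'
    (m%:R * C) r'0 r'r mC0 Cr'.
- move=> z u v zr; rewrite opprD addrACA subrr addr0 -mulmxBl.
  by apply: mulmx_norm_le => // i j; apply: le_trans (mx_entry_le_norm _ i j) (AC z zr).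
- move=> c u cc cu cr t; apply: cvgD.
    apply: cvg_mulmx; first exact: cu.
    exact: (continuous_comp (cc t) (Ck_continuous cA (cr t))).
  exact: (continuous_comp (cc t) (Ck_continuous cB (cr t))).
move=> delta [ddelta delta0].
have cdelta : Ck_on k (cube r') delta.
  have crow i : Ck_on k (cube r') (fun z => row i (delta z)).
    apply: (IH r' C A (fun z => row i (B z)) (fun z => row i (Jac beta z))) => //.
    - by move=> z /inr; exact: AC.
    - exact: Ck_subset (Ck_pred cA).
    - apply: (@Ck_subset _ _ _ (cube r)) => //; apply/(Ck_mx _ _ oQ) => a j;
        under eq_fun do rewrite mxE.
      by have /(Ck_mx _ _ oQ) := cB; exact.
    - apply: (@Ck_subset _ _ _ (cube r)) => //; apply/(Ck_mx _ _ oQ) => a j;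
        under eq_fun do rewrite mxE.
      by have /(Ck_mx _ _ oQ) := Ck_Jac oQ cbeta; exact.
    - move=> z zr; have /is_derive_mxP H := ddelta z zr.
      apply/is_derive_mxP => a j; under eq_fun do rewrite mxE.
      by rewrite -row_mul -linearD mxE.
    - by move=> z zr zt; rewrite delta0.
  apply/(Ck_mx _ _ (@open_cube R n r')) => i j.
  have /(Ck_mx _ _ (@open_cube R n r')) /(_ 0 j) := crow i.
  by under eq_fun do rewrite mxE.
have dD z1 : cube r' z1 -> differentiable y z1 /\ forall i, 'D_(delta_mx 0 i) y z1 =
    if i == tau then y z1 *m A z1 + b z1 else row i (delta z1).
  move=> z1r'; have z1r := inr _ z1r'.
  have z1t := cube_coord tau z1r'.
  have abs0 : `|0 : R| < r' by rewrite normr0.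
  have z10 : cube r (set_coord tau z1 0) by apply: inr; exact: cube_set_coord.
  have inl z : cube r z -> cube r (inline z1 z).
    by move=> zr; apply: cube_set_coord => //; exact: cube_coord.
  (* The Jacobians in [B] are replaced by Hadamard matrices between [z] and its projection, which
     makes the equation for differences exact; on the time line of [z1] they reduce to [B]. *)
  apply: (@ode_differentiable R n m tau y (fun z => y z *m A z + b z) A
    (fun z => hadamard_mx b (inline z1 z) z +
       \sum_a y (inline z1 z) 0 a *: hadamard_mx (rowA a) (inline z1 z) z)
    (fun z => hadamard_mx beta (set_coord tau z1 0) z) delta r r' C z1 r'0 r'r z1r' C0 Cr dy
    (Ck_continuous cA) AC).
  - move=> z zr; apply: for_continuousD.
      exact: (hadamard_line_continuous (c1 _ _ cb)).
    apply: (@cvg_big _ _ +%R 0 xpredT _ _ (nbhs z)) => [|a _]; first exact: add_continuous.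
    apply: cvgZ; last exact: (hadamard_line_continuous (c1 _ _ (crowA a))).
    apply: (@continuous_comp _ _ _ (fun w : 'rV[R]_n => y (inline z1 w))
        (fun M : 'rV[R]_m => M 0 a)); last exact: coord_continuous.
    apply: (@continuous_comp _ _ _ (inline z1) y); first exact: set_coord_line_continuous.
    by apply: (Ck_continuous cy); exact: inl.
  - by move=> z zr; exact: (hadamard_const_continuous (c1 _ _ cbeta)).
  - move=> z zr z'; have z'r : cube r z' by exact: inl.
    rewrite mulmxDr -(hadamard oQ (@segment_closed_cube _ _ r) (c1 _ _ cb))//.
    have -> : (z - z') *m (\sum_a y z' 0 a *: hadamard_mx
        (rowA a) z' z) = y z' *m A z - y z' *m A z'.
      rewrite mulmx_sumr !mulmx_sum_row -sumrB; apply: eq_bigr => a _.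
      by rewrite -scalemxAr -(hadamard oQ (@segment_closed_cube _ _ r) (c1 _ _
          (crowA a)))// scalerBr.
    have alg (a1 a2 a3 a4 a5 : 'rV[R]_m) :
        a1 + a2 - (a3 + a4) = a1 - a5 + (a2 - a4 + (a5 - a3)).
      by apply/rowP => i; rewrite !mxE; ring.
    by rewrite mulmxBl; exact: alg.
  - move=> z zr zt z'; rewrite !ybeta ?set_coord_tau//.
    by rewrite -(hadamard oQ (@segment_closed_cube _ _ r) (c1 _ _ cbeta)).
  - move=> s sr z'; have := ddelta z' (cube_set_coord tau z1r' sr).
    have -> : inline z1 z' = z' by rewrite /inline set_coord_tau.
    have -> : B z' = hadamard_mx b z' z' + \sum_a y z' 0 a *: hadamard_mx (rowA a) z' z'.
      rewrite /B hadamard_mx_diag; congr (_ + _).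
      by apply: eq_bigr => a _; rewrite hadamard_mx_diag.
    exact.
  - by rewrite hadamard_mx_diag delta0 ?set_coord_tau//; exact: cube_set_coord.
(* The time derivative is C^k through the equation itself, the other partial derivatives as rows of
   [delta]. *)
apply: (Ck_mx_basis (@open_cube R n r')) => [z1 /dD[]//|i].
case: (eqVneq i tau) => it.
  apply: (Ck_ext (f := fun z => y z *m A z + b z) (@open_cube R n r')).
    by move=> z1 /dD[_ ->]; rewrite it eqxx.
  apply: (@Ck_subset _ _ _ (cube r)) => //.
  by apply: Ck_mxD => //; [apply: Ck_mulmx => //; exact: Ck_pred|exact: Ck_pred].
apply: (Ck_ext (f := fun z => row i (delta z)) (@open_cube R n r')).
  by move=> z1 /dD[_ ->]; rewrite (negbTE it).
apply/(Ck_mx _ _ (@open_cube R n r')) => a j; under eq_fun do rewrite mxE.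
by have /(Ck_mx _ _ (@open_cube R n r')) := cdelta; exact.
Qed.

(** Bootstrap through the variational equation: if [y] is C^k, so is its coefficient [Jac Z] at [y];
    [affine_Ck] makes its solutions C^k, and these are the parameter derivatives of [y]. *)
Lemma flow_Ck (D : set 'rV[R]_m) (Z : 'rV[R]_m -> 'rV[R]_m) r C beta y k :
  open D -> segment_closed D -> smooth_on D Z -> 0 <= C ->
  (forall u, D u -> `|Jac Z u| <= C) -> m%:R * C * r <= 2^-1 ->
  smooth_on (cube r) beta -> (forall z, cube r z -> D (y z)) ->
  (forall z, cube r z -> is_derive z e_tau y (Z (y z))) ->
  (forall z, cube r z -> z 0 tau = 0 -> y z = beta z) ->
  Ck_on k (cube r) y.
Proof.
move=> oD sD cZ C0 ZC Cr cbeta Dy dy ybeta.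
have oQ := @open_cube R n r.
have hZ := hadamard oD sD (cZ 1%N).
elim: k => [|k cy].
  apply: (@ode_continuous R n tau 1 m (fun z u => Z u) y beta r (m%:R * C) _ Cr dy ybeta
    (cbeta 0%N)).
  - by rewrite mulr_ge0.
  - move=> z w zr wr; rewrite hZ; [|exact: Dy|exact: Dy].
    apply: mulmx_norm_le => // i j; apply: le_trans (mx_entry_le_norm _ i j) _.
    by apply: (hadamard_mx_le oD sD (cZ 1%N)) => //; exact: Dy.
  - move=> z zr; apply: (@continuous_comp _ _ _
        (fun w : 'rV[R]_n => y (set_coord tau z (w 0 tau))) Z).
      by apply: is_derive_line_continuous; exact: dy.
    by apply: (cZ 0%N); rewrite set_coord_id; exact: Dy.
pose A z := Jac Z (y z).
have cA : Ck_on k (cube r) A.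
  by apply: (Ck_comp_mx oQ oD Dy _ cy); apply: Ck_Jac.
have AC z : cube r z -> `|A z| <= C by move=> zr; apply: ZC; exact: Dy.
apply: Ck_local => z0 /cube_between[r' [r'0 r'r z0r']]; exists (cube r') => //.
have inr (z : 'rV[R]_n) : cube r' z -> cube r z by apply: cube_le; exact: ltW.
have Cr' : m%:R * C * r' <= 2^-1.
  by apply: le_trans Cr; rewrite ler_wpM2l ?mulr_ge0// ltW.
have mC0 : 0 <= m%:R * C by rewrite mulr_ge0.
have [] := @ode_exists R n tau n m (fun z u => u *m A z) (Jac beta) r r' (m%:R * C) r'0 r'r mC0 Cr'.
- move=> z u v zr; rewrite -mulmxBl.
  by apply: mulmx_norm_le => // i j; apply: le_trans (mx_entry_le_norm _ i j) (AC z zr).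
- move=> c u cc cu cr t; apply: cvg_mulmx; first exact: cu.
  exact: (continuous_comp (cc t) (Ck_continuous cA (cr t))).
move=> delta [ddelta delta0].
have cdelta i : Ck_on k (cube r') (fun z => row i (delta z)).
  apply: (@affine_Ck k r' C A (fun=> 0) (fun z => row i (Jac beta z))) => //.
  - by move=> z /inr; exact: AC.
  - exact: Ck_subset cA.
  - exact: Ck_cst.
  - apply: (@Ck_subset _ _ _ (cube r)) => //; apply/(Ck_mx _ _ oQ) => a j;
      under eq_fun do rewrite mxE.
    by have /(Ck_mx _ _ oQ) := Ck_Jac oQ (cbeta k.+1); exact.
  - move=> z zr; have /is_derive_mxP H := ddelta z zr.
    apply/is_derive_mxP => a j; under eq_fun do rewrite mxE.
    by rewrite -row_mul addr0 mxE.
  - by move=> z zr zt; rewrite delta0.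
have dD z1 : cube r' z1 -> differentiable y z1 /\ forall i, 'D_(delta_mx 0 i) y z1 =
    if i == tau then Z (y z1) else row i (delta z1).
  move=> z1r'; have z1r := inr _ z1r'.
  have z1t := cube_coord tau z1r'.
  have abs0 : `|0 : R| < r' by rewrite normr0.
  have z10 : cube r (set_coord tau z1 0) by apply: inr; exact: cube_set_coord.
  have inl z : cube r z -> cube r (inline z1 z).
    by move=> zr; apply: cube_set_coord => //; exact: cube_coord.
  (* Hadamard's matrix between the two solution values expresses the difference of [Z] linearly in
     their difference, so the source term is zero. *)
  apply: (@ode_differentiable R n m tau y (fun z => Z (y z))
    (fun z => hadamard_mx Z (y (inline z1 z)) (y z)) (fun=> 0)
    (fun z => hadamard_mx beta (set_coord tau z1 0) z) delta r r' C z1 r'0 r'r z1r' C0 Cr dy).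
  - move=> z zr; apply: (hadamard_mx_continuous (b := y) oD sD (cZ 1%N)).
    + apply: (@continuous_comp _ _ _ (inline z1) y); first exact: set_coord_line_continuous.
      by apply: (Ck_continuous cy); exact: inl.
    + exact: (Ck_continuous cy).
    by apply: filterS (nbhs_cube zr) => w wr; split; apply: Dy => //; exact: inl.
  - move=> z zr; apply: (hadamard_mx_le oD sD (cZ 1%N)) => //; first exact/Dy/inl.
    exact: Dy.
  - by move=> z zr; exact: (@cvg_cst _ _ _ (nbhs z)).
  - by move=> z zr; exact: (hadamard_const_continuous (cbeta 1%N)).
  - by move=> z zr z'; rewrite mulmx0 addr0 -hZ//; apply: Dy => //; exact: inl.
  - move=> z zr zt z'; rewrite !ybeta ?set_coord_tau//.
    by rewrite -(hadamard oQ (@segment_closed_cube _ _ r) (cbeta 1%N)).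
  - move=> s sr z'; have := ddelta z' (cube_set_coord tau z1r' sr).
    have -> : inline z1 z' = z' by rewrite /inline set_coord_tau.
    by rewrite hadamard_mx_diag addr0.
  - by rewrite hadamard_mx_diag delta0 ?set_coord_tau//; exact: cube_set_coord.
apply: (Ck_mx_basis (@open_cube R n r')) => [z1 /dD[]//|i].
case: (eqVneq i tau) => it.
  apply: (Ck_ext (f := Z \o y) (@open_cube R n r')).
    by move=> z1 /dD[_ ->]; rewrite it eqxx.
  apply: (@Ck_subset _ _ _ (cube r)) => //.
  exact: (Ck_comp_mx oQ oD Dy (cZ k)).
apply: (Ck_ext (f := fun z => row i (delta z)) (@open_cube R n r')) => //.
by move=> z1 /dD[_ ->]; rewrite (negbTE it).
Qed.

End flow_smooth.

Section local_flow.
Context {R : realType}.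

Lemma nbhs_cubeP {n} (P : set 'rV[R]_n) : nbhs (0 : 'rV[R]_n) P ->
  exists2 r, 0 < r & forall z, cube r z -> P z.
Proof. by move=> /nbhs_ballP[r /= r0 rP]; exists r => // z zr; apply: rP; rewrite -cubeE. Qed.

Let clamp_mx {m} (c : R) (u : 'rV[R]_m) : 'rV[R]_m := map_mx (clamp (- c) c) u.

Let clamp_mx_le m c (u : 'rV[R]_m) : 0 <= c -> `|clamp_mx c u| <= c.
Proof.
move=> c0; apply: (introT (mx_norm_leP _ c0)) => i j.
by rewrite mxE ler_norml clamp_in// ge0_cp.
Qed.

Let clamp_mx_id m c (u : 'rV[R]_m) : `|u| <= c -> clamp_mx c u = u.
Proof.
move=> uc; apply/rowP => j; rewrite mxE clamp_id// -ler_norml.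
by apply: le_trans uc; exact: mx_entry_le_norm.
Qed.

Let clamp_mx_lip m c (u v : 'rV[R]_m) : `|clamp_mx c u - clamp_mx c v| <= `|u - v|.
Proof.
apply: (introT (mx_norm_leP _ (normr_ge0 _))) => i j.
rewrite !mxE (le_trans (clamp_lip _ _ _ _))//.
by have := mx_entry_le_norm (u - v) i j; rewrite !mxE.
Qed.

(** The field is made globally Lipschitz by a retraction onto a ball about the initial value; for
    short times the solution stays where the retraction is the identity and hence follows [Z]. *)
Lemma local_flow n m (tau : 'I_n) (D : set 'rV[R]_m) (Z : 'rV[R]_m -> 'rV[R]_m)
    (beta : 'rV[R]_n -> 'rV[R]_m) (r0 : R) :
  open D -> smooth_on D Z -> 0 < r0 -> smooth_on (cube r0) beta -> D (beta 0) ->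
  exists (r : R) (y : 'rV[R]_n -> 'rV[R]_m),
    [/\ 0 < r, r <= r0, smooth_on (cube r) y, forall z, cube r z -> D (y z) &
     (forall z, cube r z -> is_derive z (delta_mx 0 tau : 'rV[R]_n) y (Z (y z))) /\
     (forall z, cube r z -> z 0 tau = 0 -> y z = beta z)].
Proof.
move=> oD cZ r00 cbeta D0; set y0 := beta 0 in D0 *.
have cJ : {for y0, continuous (Jac Z)} by exact: (Ck_Jac oD (cZ 1%N)).
have cZ0 : {for y0, continuous Z} by exact: (cZ 0%N).
move/for_continuousP : cJ => /(_ _ ltr01) cJ.
move/for_continuousP : cZ0 => /(_ _ ltr01) cZ0.
have nD : nbhs y0 D by exact: open_nbhs_nbhs.
have /nbhs_ballP[rho /= rho0 rhoP] : nbhs y0 (D `&`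
    ([set t | `|Jac Z y0 - Jac Z t| <= 1] `&` [set t | `|Z y0 - Z t| <= 1])).
  by apply: filterI => //; exact: filterI.
pose D' : set 'rV[R]_m := [set u | `|u - y0| < rho].
have D'P u : D' u -> [/\ D u, `|Jac Z u| <= `|Jac Z y0| + 1 & `|Z u| <= `|Z y0| + 1].
  move=> uD'; have [] : (D `&` ([set t | `|Jac Z y0 - Jac Z t| <= 1] `&` [set t | `|Z y0 - Z t|
      <= 1])) u.
    by apply: rhoP; rewrite -ball_normE /= distrC.
  move=> Du [/= J1 Z1]; split=> //.
    by rewrite -[in leLHS](subrKC (Jac Z y0) (Jac Z u)) (le_trans (ler_normD _ _))// lerD2l distrC.
  by rewrite -[in leLHS](subrKC (Z y0) (Z u)) (le_trans (ler_normD _ _))// lerD2l distrC.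
set C := `|Jac Z y0| + 1 in D'P; set M := `|Z y0| + 1 in D'P.
have C0 : 0 <= C by rewrite addr_ge0.
have M0 : 0 < M by rewrite ltr_wpDl.
have oD' : open D'.
  have -> : D' = ball y0 rho by rewrite -ball_normE; apply/seteqP; split=> u /=;
      rewrite /D' /= distrC.
  exact: ball_open.
have sD' : segment_closed D' by exact: segment_closed_ball.
have cZ' : smooth_on D' Z by move=> k; apply: Ck_subset (cZ k) => u /D'P[].
have hZ := hadamard oD' sD' (cZ' 1%N).
pose cl (u : 'rV[R]_m) := y0 + clamp_mx (rho / 2) (u - y0).
have rho2 : 0 <= rho / 2 by rewrite divr_ge0// ltW.
have clD u : D' (cl u).
  by rewrite /D' /= /cl addrC addKr (le_lt_trans (clamp_mx_le _ rho2))//; lra.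
have mC0 : 0 <= m%:R * C by rewrite mulr_ge0.
have lipZ u v : `|Z (cl u) - Z (cl v)| <= m%:R * C * `|u - v|.
  rewrite hZ//; apply: le_trans (_ : m%:R * C * `|cl u - cl v| <= _).
    apply: mulmx_norm_le => // i j; apply: le_trans (mx_entry_le_norm _ i j) _.
    by apply: (hadamard_mx_le oD' sD' (cZ' 1%N)) => // z /D'P[].
  rewrite ler_wpM2l// /cl opprD addrACA subrr add0r (le_trans (clamp_mx_lip _ _ _))//.
  by rewrite opprB addrA subrK.
have rho4 : 0 < rho / 4 by rewrite divr_gt0.
have [r1 r10 r1P] : exists2 r, 0 < r & forall z, cube r z -> `|y0 - beta z| <= rho / 4.
  apply: nbhs_cubeP; have c0 : {for (0 : 'rV[R]_n), continuous beta}.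
    by apply: (cbeta 0%N); rewrite /cube /= normr0.
  by move/for_continuousP : c0; exact.
(* Initial values stay within rho/4 of [y0] by [r1], and at speed at most [M] a solution travels at
   most rho/8, so the total is below the retraction radius rho/2. The last bound yields
   [m%:R * C * r <= 1/2]. *)
pose r := Num.min (Num.min r0 r1) (Num.min (rho / (8 * M)) (2 * (m%:R * C + 1))^-1).
have mC1 : 0 < m%:R * C + 1 by rewrite ltr_wpDl.
have rp : 0 < r.
  by rewrite !lt_min r00 r10 divr_gt0 ?mulr_gt0//= invr_gt0 mulr_gt0.
have rr0 : r <= r0 by rewrite !ge_min lexx.
have rr1 : r <= r1 by rewrite !ge_min lexx orbT.
have rM : r * M <= rho / 8.
  rewrite -ler_pdivlMr// (_ : _ / M = rho / (8 * M)); first by rewrite !ge_min lexx !orbT.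
  by rewrite invfM mulrA.
have rC : m%:R * C * r <= 2^-1.
  apply: le_trans (_ : (m%:R * C + 1) * r <= _).
    by rewrite ler_wpM2r// ?(ltW rp)// lerDl.
  rewrite mulrC -ler_pdivlMr// -invfM; first by rewrite !ge_min lexx !orbT.
pose r' := r / 2.
have r'0 : 0 < r' by rewrite divr_gt0.
have r'r : r' < r by rewrite /r'; lra.
have rC' : m%:R * C * r' <= 2^-1 by apply: le_trans rC; rewrite ler_wpM2l// ltW.
have [||y [dy ybeta]] := @ode_exists R n tau 1 m (fun z u => Z (cl u)) beta r r'
    (m%:R * C) r'0 r'r mC0 rC'.
- by move=> z u v _; exact: lipZ.
- move=> c u cc cu cr t; apply/for_continuousP => e e0.
  have e1 : 0 < e / (m%:R * C + 1) by rewrite divr_gt0.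
  have := cu t; move=> /for_continuousP /(_ _ e1); apply: filterS => s H.
  apply: le_trans (lipZ _ _) _.
  apply: le_trans (_ : (m%:R * C + 1) * `|u t - u s| <= _).
    by rewrite ler_wpM2r// lerDl.
  by rewrite mulrC -ler_pdivlMr.
have yz0 z : cube r' z -> `|y z - y0| <= rho / 2.
  move=> zr; have zt := cube_coord tau zr.
  have abs0 : `|0 : R| < r' by rewrite normr0.
  have H1 : `|y z - y (set_coord tau z 0)| <= M * `|z 0 tau|.
    have := @MVI R 1 m (fun t => y (set_coord tau z t)) (fun t => Z (cl (y (set_coord tau z t))))
      `|z 0 tau| M _ _ (z 0 tau) (lexx _).
    rewrite set_coord_id; apply=> t tz.
      by apply/is_derive_set_coord; apply: dy; apply: cube_set_coord => //; exact: le_lt_trans zt.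
    by have [] := D'P _ (clD (y (set_coord tau z t))).
  have H2 : `|y (set_coord tau z 0) - y0| <= rho / 4.
    have zr0 := cube_set_coord tau zr abs0.
    rewrite ybeta ?set_coord_tau// distrC; apply: r1P.
    by apply: cube_le zr0; exact: le_trans (ltW r'r) rr1.
  have H3 : M * `|z 0 tau| <= rho / 8.
    apply: le_trans rM; rewrite mulrC ler_wpM2r ?(ltW M0)//.
    exact: le_trans (ltW zt) (ltW r'r).
  have := ler_distD (y (set_coord tau z 0)) (y z) y0; lra.
have ycl z : cube r' z -> cl (y z) = y z.
  by move=> /yz0 H; rewrite /cl clamp_mx_id// subrKC.
have yD z : cube r' z -> D' (y z) by move=> zr; rewrite -ycl.
have dy' z : cube r' z -> is_derive z (delta_mx 0 tau : 'rV[R]_n) y (Z (y z)).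
  by move=> zr; have := dy z zr; rewrite ycl.
exists r', y; split=> //.
- exact: le_trans (ltW r'r) rr0.
- move=> k; apply: (@flow_Ck R n m tau D' Z r' C beta y k) => //.
    by move=> u /D'P[].
  move=> j; apply: Ck_subset (cbeta j) => z; apply: cube_le.
  exact: le_trans (ltW r'r) rr0.
- by move=> z /yD /D'P[].
Qed.

End local_flow.

(** * Inverse function theorem *)

Section inverse_function.
Context {R : realType}.

Lemma is_derive_mulmxr (V : normedModType R) p q r (A : 'M[R]_(q, r))
    (f : V -> 'M[R]_(p, q)) x v df :
  is_derive x v f df -> is_derive x v (fun s => f s *m A) (df *m A).
Proof.
move=> /is_derive_mxP dfx; apply/is_derive_mxP => i j.
have -> : (fun s => (f s *m A) i j) = \sum_k (fun s => A k j * f s i k).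
  by apply/funext => s; rewrite mxE fct_sumE; apply: eq_bigr => k _; rewrite mulrC.
have -> : (df *m A) i j = \sum_k A k j * df i k.
  by rewrite mxE; apply: eq_bigr => k _; rewrite mulrC.
exact: is_derive_sum.
Qed.

Context {n : nat}.
Implicit Types (f g : 'rV[R]_n -> 'rV[R]_n) (U V W : set 'rV[R]_n).

Lemma open_ball_norm (c : 'rV[R]_n) r : open [set x | `|x - c| < r].
Proof.
have -> : [set x | `|x - c| < r] = ball c r.
  by rewrite -ball_normE; apply/seteqP; split=> u /=; rewrite distrC.
exact: ball_open.
Qed.

(** Banach's theorem on the closed ball: the contraction uses half of the radius and the offset at
    [p] the other half. *)
Lemma near_identity_fixpoint (phi : 'rV[R]_n -> 'rV[R]_n) p rho w :
  (forall x y, `|x - p| <= rho -> `|y - p| <= rho -> `|phi x - phi y| <= 2^-1 * `|x - y|) ->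
  0 < rho -> `|phi p + w - p| <= rho / 2 ->
  exists2 x, `|x - p| <= rho & x = phi x + w.
Proof.
move=> phi_lip rho0 wp.
pose S := closed_ball p rho.
have SE x : S x <-> `|x - p| <= rho.
  by rewrite /S closed_ballE// /closed_ball_ /= distrC.
have hom : {homo (fun x => phi x + w) : x / S x >-> S x}.
  move=> x /SE xp; apply/SE.
  have pp : `|p - p| <= rho by rewrite subrr normr0 ltW.
  have := phi_lip _ _ xp pp.
  have -> : phi x + w - p = (phi x - phi p) + (phi p + w - p).
    by apply/rowP => i; rewrite !mxE; ring.
  by move=> H; apply: le_trans (ler_normD _ _) _; lra.
pose X : completeNormedModType R := HB.pack 'rV[R]_n.
have [|||x Sx xE] := @banach_fixed_point R X S (mkfun hom) _ _ _.
- have h0 : 0 <= 2^-1 :> R by [].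
  exists (NngNum h0); split=> /=; first by rewrite invf_lt1// ltr1n.
  move=> [x y] /= [/SE Sx /SE Sy].
  by rewrite opprD addrACA subrr addr0; exact: phi_lip.
- exact: closed_ball_closed.
- by exists p; apply/SE; rewrite subrr normr0 ltW.
by exists x => //; exact/SE.
Qed.

(** Solving [f x = u] means [x = phi x + u *m M], where [phi] has zero Jacobian at [p] and so
    contracts nearby. Hadamard's factorization of [phi] gives invertibility of difference quotients,
    hence differentiability of the inverse. *)
Theorem inverse_function f U p : open U -> U p -> smooth_on U f ->
  Jac f p \in unitmx ->
  exists V W g, [/\ open V, open W, V p, V `<=` U &
    [/\ forall x, V x -> W (f x) /\ g (f x) = x,
        forall u, W u -> V (g u) /\ f (g u) = u & smooth_on W g]].
Proof.
move=> oU Up cf Ju.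
pose M := invmx (Jac f p).
(* Newton's map: its fixed points, up to a translation, solve [f x = u]. *)
pose phi x := x + f x *m (- M).
have cphi : smooth_on U phi.
  move=> k; apply: Ck_mxD => //; first exact: Ck_id.
  by apply: Ck_mulmx => //; exact: Ck_cst.
have phiE x y : (f x - f y) *m M = (x - y) - (phi x - phi y).
  by rewrite /phi !mulmxN mulmxBl; apply/rowP => i; rewrite !mxE; ring.
have Jphi0 : Jac phi p = 0.
  apply/row_matrixP => i; rewrite row_Jac row0.
  have df := diff_derivable (v := delta_mx 0 i) ((cf 1%N).1 p Up).
  have := is_deriveD (is_derive_id p (delta_mx 0 i : 'rV[R]_n)) (is_derive_mulmxr (- M)
      (derivableP df)).
  rewrite -row_Jac rowE -mulmxA mulmxN mulmxV// mulmxN mulmx1 subrr.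
  by move=> /@derive_val.
have cJ : {for p, continuous (Jac phi)} by exact: (Ck_Jac oU (cphi 1%N)).
(* Chosen so that [n * c <= 1/2]: matrices with entries bounded by [c] at least halve norms. *)
pose c : R := (2 * (n%:R + 1))^-1.
have n1 : 0 < n%:R + 1 :> R by rewrite ltr_wpDl.
have c0 : 0 < c by rewrite invr_gt0 mulr_gt0.
have nc : n%:R * c <= 2^-1.
  by rewrite /c invfM mulrCA ger_pMr// ler_pdivrMr// mul1r lerDl.
move/for_continuousP : cJ => /(_ _ c0); rewrite Jphi0 => cJ.
have nU : nbhs p U by exact: open_nbhs_nbhs.
have /nbhs_ballP[rho /= rho0 rhoP] : nbhs p (U `&` [set x | `|0 - Jac phi x| <= c]).
  exact: filterI.
pose D : set 'rV[R]_n := [set x | `|x - p| < rho].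
have DP x : D x -> U x /\ `|Jac phi x| <= c.
  move=> xD; have [] : (U `&` [set x | `|0 - Jac phi x| <= c]) x.
    by apply: rhoP; rewrite -ball_normE /= distrC.
  by move=> Ux; rewrite /= sub0r normrN.
have oD : open D by exact: open_ball_norm.
have sD : segment_closed D by exact: segment_closed_ball.
have DU : D `<=` U by move=> x /DP[].
have cphiD : smooth_on D phi by move=> k; apply: Ck_subset (cphi k).
have hphi := hadamard oD sD (cphiD 1%N).
pose N x y : 'M[R]_n := 1%:M - hadamard_mx phi x y.
have hle x y v : D x -> D y -> `|v *m hadamard_mx phi x y| <= 2^-1 * `|v : 'rV[R]_n|.
  move=> Dx Dy; apply: le_trans (_ : n%:R * c * `|v| <= _); last by rewrite ler_wpM2r.
  apply: mulmx_norm_le => [|i j]; first exact: ltW.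
  apply: le_trans (mx_entry_le_norm _ i j) _.
  by apply: (hadamard_mx_le oD sD (cphiD 1%N)) => // z /DP[].
have NE x y : D x -> D y -> (f y - f x) *m M = (y - x) *m N x y.
  by move=> Dx Dy; rewrite phiE hphi// mulmxBr mulmx1.
(* A vector killed by [N x y] is fixed by a matrix that halves norms, hence zero. *)
have Nu x y : D x -> D y -> N x y \in unitmx.
  move=> Dx Dy; rewrite -row_free_unit; apply: inj_row_free => v.
  rewrite mulmxBr mulmx1 => /eqP; rewrite subr_eq0 => /eqP vE.
  apply/eqP; rewrite -normr_le0; have := hle x y v Dx Dy; rewrite -vE.
  have := normr_ge0 v; lra.
have phi_lip x y : D x -> D y -> `|phi x - phi y| <= 2^-1 * `|x - y|.
  by move=> Dx Dy; rewrite hphi//; exact: hle.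
have f_lip x y : D x -> D y -> `|x - y| <= 2 * `|(f x - f y) *m M|.
  move=> Dx Dy; rewrite phiE; have := phi_lip x y Dx Dy.
  have := ler_normB (x - y) (phi x - phi y).
  have := ler_normD (x - y - (phi x - phi y)) (phi x - phi y).
  rewrite subrK; lra.
(* The fixed point is sought in the closed ball of radius rho/2, inside the open [D], which allows
   an offset of rho/4. *)
pose W : set 'rV[R]_n := [set u | `|(u - f p) *m M| < rho / 4].
pose V : set 'rV[R]_n := D `&` f @^-1` W.
have cW : continuous (fun u : 'rV[R]_n => `|(u - f p) *m M|).
  move=> u; apply: (@continuous_comp _ _ _ (fun u : 'rV[R]_n => (u - f p) *m M) Num.norm);
      last exact: norm_continuous.
  apply: for_continuous_mulmx; last exact: (@cvg_cst _ _ _ (nbhs u)).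
  by apply: for_continuousD; [exact: (@cvg_id _ (nbhs u))|exact: (@cvg_cst _ _ _ (nbhs u))].
have oW : open W.
  by have := open_comp (fun u _ => cW u) (@open_lt R (rho / 4)).
have oV : open V.
  rewrite openE => x [Dx Wx]; apply: filterI; first exact: open_nbhs_nbhs.
  have cfx : {for x, continuous f} by apply: (cf 0%N); exact: DU.
  by apply: cfx; exact: open_nbhs_nbhs.
have surj u : W u -> exists2 x, V x & f x = u.
  move=> Wu; have rho2 : 0 < rho / 2 by rewrite divr_gt0.
  have inD x : `|x - p| <= rho / 2 -> D x.
    by rewrite /D /= => /le_lt_trans; apply; lra.
  have [||x xp xE] := @near_identity_fixpoint phi p (rho / 2) (u *m M) _ rho2.
  - by move=> x y /inD Dx /inD Dy; exact: phi_lip.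
  - have -> : phi p + u *m M - p = (u - f p) *m M.
      by rewrite /phi mulmxN mulmxBl; apply/rowP => i; rewrite !mxE; ring.
    by move: Wu; rewrite /W /=; lra.
  have fx : f x = u.
    apply/eqP; rewrite -subr_eq0; apply/eqP.
    have Mu : M \in unitmx by rewrite unitmx_inv.
    rewrite -[LHS](mulmxK Mu) mulmxBl.
    have -> : f x *m M = u *m M.
      apply/eqP; rewrite -subr_eq0; apply/eqP.
      move: xE; rewrite /phi mulmxN => /eqP; rewrite -subr_eq0 => /eqP <-.
      by apply/rowP => i; rewrite !mxE; ring.
    by rewrite subrr mul0mx.
  by exists x => //; split; [exact: inD|rewrite /= fx].
pose g u := get [set x | V x /\ f x = u].
have gP u : W u -> V (g u) /\ f (g u) = u.
  by move=> /surj[x Vx fx]; apply: (@getPex _ [set x | V x /\ f x = u]); exists x.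
have gf x : V x -> g (f x) = x.
  move=> Vx; have [Vg fg] := gP (f x) Vx.2.
  apply/eqP; rewrite -subr_eq0 -normr_le0.
  by have := f_lip _ _ Vg.1 Vx.1; rewrite fg subrr mul0mx normr0 mulr0.
have gD u : W u -> D (g u) by move=> /gP[[]].
have cg : Ck_on 0 W g.
  move=> u Wu; apply/for_continuousP => e e0.
  have cu : {for u, continuous (fun v : 'rV[R]_n => (u - v) *m M)}.
    apply: for_continuous_mulmx; last exact: (@cvg_cst _ _ _ (nbhs u)).
    by apply: for_continuousD; [exact: (@cvg_cst _ _ _ (nbhs u))|exact: opp_continuous].
  have e2 : 0 < e / 2 by rewrite divr_gt0.
  move/for_continuousP : cu => /(_ _ e2); rewrite subrr mul0mx.
  have nW : nbhs u W by exact: open_nbhs_nbhs.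
  apply: filterS2 nW => v Wv; rewrite sub0r normrN => H.
  have := f_lip _ _ (gD u Wu) (gD v Wv).
  by rewrite (gP u Wu).2 (gP v Wv).2 => /le_trans; apply; lra.
(* Inverting [NE] factors [g v - g u] through [M *m invmx (N (g u) (g v))], continuous in [v]
   because [g] is. *)
have dg u : W u -> differentiable g u /\ Jac g u = M *m invmx (1%:M - Jac phi (g u)).
  move=> Wu.
  have := @differentiable_factor R n n g (fun v => M *m invmx (N (g u) (g v))) u.
  have nW : nbhs u W by exact: open_nbhs_nbhs.
  have <- : N (g u) (g u) = 1%:M - Jac phi (g u) by rewrite /N hadamard_mx_diag.
  apply.
    apply: filterS nW => v Wv.
    have NN := Nu _ _ (gD u Wu) (gD v Wv).
    have := NE _ _ (gD u Wu) (gD v Wv); rewrite (gP u Wu).2 (gP v Wv).2 mulmxA => ->.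
    by rewrite mulmxK.
  have : Ck_on 0 W (fun v => M *m invmx (N (g u) (g v))).
    apply: (Ck_mulmx oW); first exact: Ck_cst.
    apply: (Ck_invmx oW); first by move=> v Wv; apply: Nu; exact: gD.
    move=> v Wv; apply: for_continuousD; first exact: (@cvg_cst _ _ _ (nbhs v)).
    apply: (@continuous_comp _ _ _ (fun v => hadamard_mx phi (g u) (g v)) -%R);
        last exact: opp_continuous.
    apply: (@hadamard_mx_continuous _ _ _ _ _ oD sD (cphiD 1%N) 'rV[R]_n (fun=> g u) g v).
    - exact: (@cvg_cst _ _ _ (nbhs v)).
    - exact: cg.
    have nWv : nbhs v W by exact: open_nbhs_nbhs.
    by apply: filterS nWv => w Ww; split; exact: gD.
  by apply.
exists V, W, g; split=> //.
- split; first by rewrite /D /= subrr normr0.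
  by rewrite /W /= subrr mul0mx normr0 divr_gt0.
- by move=> x [/DU].
split=> [x Vx|u Wu|k]; [by split; [exact: Vx.2|exact: gf]|exact: gP|].
(* The formula for [Jac g] is as regular as [g], so each step gains one derivative. *)
elim: k => [//|k IH]; apply: (Ck_mx_basis oW) => [u /dg[]//|i].
apply: (Ck_ext (f := fun u => row i (M *m invmx (1%:M - Jac phi (g u)))) oW).
  by move=> u Wu; rewrite -row_Jac (dg u Wu).2.
apply/(Ck_mx _ _ oW) => a j; under eq_fun do rewrite mxE.
have : Ck_on k W (fun u => M *m invmx (1%:M - Jac phi (g u))).
  apply: (Ck_mulmx oW); first exact: Ck_cst.
  apply: (Ck_invmx oW).
    move=> u Wu; have := Nu _ _ (gD u Wu) (gD u Wu).
    by rewrite /N hadamard_mx_diag.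
  apply: Ck_mxD => //; first exact: Ck_cst.
  have cJD : Ck_on k D (Jac phi) by exact: Ck_Jac.
  apply: (Ck_ext (f := fun u => Jac phi (g u) *m - 1%:M) oW).
    by move=> u _; rewrite mulmxN mulmx1.
  by apply: Ck_mulmx (Ck_comp_mx oW oD gD cJD IH) _ => //; exact: Ck_cst.
by move=> /(Ck_mx _ _ oW); exact.
Qed.

End inverse_function.

(** * Adapted charts *)

Section pullback.
Context {R : realType}.

Lemma is_derive_mulmx (V : normedModType R) p q r (f : V -> 'M[R]_(p, q))
    (g : V -> 'M[R]_(q, r)) x v df dg :
  is_derive x v f df -> is_derive x v g dg ->
  is_derive x v (fun y => f y *m g y) (df *m g x + f x *m dg).
Proof.
move=> /is_derive_mxP dfx /is_derive_mxP dgx; apply/is_derive_mxP => i j.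
have -> : (fun s => (f s *m g s) i j) = \sum_k (fun s => f s i k * g s k j).
  by apply/funext => s; rewrite mxE fct_sumE.
have -> : (df *m g x + f x *m dg) i j = \sum_k (f x i k * dg k j + g x k j * df i k).
  rewrite !mxE -big_split; apply: eq_bigr => k _ /=.
  by rewrite addrC [df i k * _]mulrC.
apply: is_derive_sum => k.
exact: (is_deriveM (dfx i k) (dgx k j)).
Qed.

(** Agreement on the line suffices, which covers functions agreeing on a hyperplane only. *)
Lemma derive_eq_line (V W : normedModType R) (f g : V -> W) x v :
  (\forall h \near (0 : R), f (h *: v + x) = g (h *: v + x)) -> 'D_v f x = 'D_v g x.
Proof.
move=> fg; have f0 := nbhs_singleton fg; rewrite scale0r add0r in f0.
rewrite /derive; congr (lim _); apply/seteqP; split; apply: near_eq_cvg;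
  apply: (@cvg_within R _); rewrite /= ; apply: filterS fg => h /= H; rewrite H f0 //.
Qed.

Lemma schwarz_mx n p q (f : 'rV[R]_n -> 'M[R]_(p, q)) U x u v : open U -> U x ->
  Ck_on 2 U f -> 'D_u ('D_v f) x = 'D_v ('D_u f) x.
Proof.
move=> oU Ux cf.
have key i j s t : ('D_s ('D_t f) x) i j = 'D_s ('D_t (fun z => f z i j : R^o)) x.
  have ct := cf.2 t.
  rewrite derive_mx; last by apply: diff_derivable; exact: ct.1.
  rewrite mxE; apply: near_eq_derive.
  apply: filterS (open_nbhs_nbhs (conj oU Ux)) => y Uy.
  by rewrite derive_mx ?mxE//; apply: diff_derivable; exact: cf.1.
apply/matrixP => i j; have /(Ck_mx _ _ oU) /(_ i j) cfij := cf.
exact: etrans (key i j u v) (etrans (schwarz u v oU Ux cfij) (esym (key i j v u))).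
Qed.

(* Coefficient form of [d (F^* a) = F^* (d a) = 0]. *)
Lemma pullback_closed n m (U : set 'rV[R]_m) (Q : set 'rV[R]_n)
    (a : 'rV[R]_m -> 'cV[R]_m) (F : 'rV[R]_n -> 'rV[R]_m) z u v :
  open Q -> Q z -> (forall z, Q z -> U (F z)) -> Ck_on 1 U a -> Ck_on 2 Q F ->
  (forall x s t, U x -> t *m 'D_s a x = s *m 'D_t a x) ->
  exists D, is_derive z u (fun y => 'D_v F y *m a (F y)) D /\
            is_derive z v (fun y => 'D_u F y *m a (F y)) D.
Proof.
move=> oQ Qz QU ca cF a_closed.
have dF := cF.1 z Qz; have da := ca.1 _ (QU z Qz).
have key s t : is_derive z s (fun y => 'D_t F y *m a (F y))
    ('D_s ('D_t F) z *m a (F z) + 'D_t F z *m 'D_('D_s F z) a (F z)).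
  apply: is_derive_mulmx.
    by apply: derivableP; apply: diff_derivable; apply: (cF.2 t).1.
  rewrite -(derive_comp_diff s dF da); apply: derivableP.
  by apply: diff_derivable; exact: differentiable_comp.
exists ('D_u ('D_v F) z *m a (F z) + 'D_v F z *m 'D_('D_u F z) a (F z)).
split; first exact: key.
(* Schwarz exchanges the second derivatives of [F], closedness of [a] the remaining terms. *)
rewrite (schwarz_mx _ _ oQ Qz cF) a_closed; last exact: QU.
exact: key.
Qed.

Lemma constant_line n p q (tau : 'I_n) (h : 'rV[R]_n -> 'M[R]_(p, q)) r z :
  (forall z, cube r z -> is_derive z (delta_mx 0 tau : 'rV[R]_n) h 0) ->
  cube r z -> h z = h (set_coord tau z 0).
Proof.
move=> dh zr; have zt := cube_coord tau zr.
apply/eqP; rewrite -subr_eq0 -normr_le0.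
have := @MVI R p q (fun t => h (set_coord tau z t)) (fun=> 0) `|z 0 tau| 0 _ _ (z 0 tau) (lexx _).
rewrite mul0r set_coord_id; apply=> t tz; last by rewrite normr0.
apply/is_derive_set_coord; apply: dh; apply: cube_set_coord => //.
exact: le_lt_trans zt.
Qed.

End pullback.

Section adapted_chart.
Context {R : realType}.
Local Notation "'e_ i" := (delta_mx 0 i : 'rV[R]_3) (at level 8, i at level 2).

Lemma ord3P (k : 'I_3) : [\/ k = 0, k = 1 | k = ord_max].
Proof.
by case: k => [[|[|[|//]]] hk]; [apply: Or31|apply: Or32|apply: Or33]; exact/val_inj.
Qed.

Variables (U : set 'rV[R]_3) (a : 'rV[R]_3 -> 'cV[R]_3).
Hypotheses (oU : open U) (ca : smooth_on U a).
Hypothesis a_closed : forall x s t, U x -> t *m 'D_s a x = s *m 'D_t a x.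

(** Closedness turns the [tau]-derivative of the component along [v] into the [v]-derivative of the
    component along [tau], which is the constant [c]. *)
Lemma flow_pullback_const (tau : 'I_3) (F : 'rV[R]_3 -> 'rV[R]_3) r c v z :
  smooth_on (cube r) F -> (forall z, cube r z -> U (F z)) ->
  (forall z, cube r z -> 'D_('e_tau) F z *m a (F z) = c) -> cube r z ->
  'D_v F z *m a (F z) =
  'D_v F (set_coord tau z 0) *m a (F (set_coord tau z 0)).
Proof.
move=> cF FU Fc zr.
apply: (@constant_line R 3 1 1 tau (fun y => 'D_v F y *m a (F y)) r z) => // y yr.
have [D [D1 D2]] := pullback_closed 'e_tau v (@open_cube R 3 r) yr FU (ca 1%N) (cF 2%N) a_closed.
have <- : D = 0; last exact: D1.
have /@derive_val <- := D2; rewrite -[RHS](derive_cst c y v); apply: near_eq_derive.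
by apply: filterS (nbhs_cube yr) => w wr; rewrite Fc.
Qed.

Variables (S : 'rV[R]_3 -> 'M[R]_3) (p : 'rV[R]_3).
Hypotheses (cS : smooth_on U S) (Up : U p).
Hypothesis Sa : forall z, U z -> S z *m a z = delta_mx 0 0.

Let Srow i z : U z -> row i (S z) *m a z = row i (delta_mx 0 0 : 'cV[R]_3).
Proof. by move=> Uz; rewrite -row_mul Sa. Qed.

Let cSrow i : smooth_on U (fun z => row i (S z)).
Proof.
move=> k; apply/(Ck_mx _ _ oU) => u j; under eq_fun do rewrite mxE.
by have /(Ck_mx _ _ oU) := cS k; exact.
Qed.

(** Directions other than [tau] are tangent to the hyperplane, so the initial data determine these
    partial derivatives. *)
Let derive_on_hyperplane (tau : 'I_3) (F G : 'rV[R]_3 -> 'rV[R]_3) r i z :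
  (forall z, cube r z -> z 0 tau = 0 -> F z = G z) -> i != tau ->
  cube r z -> z 0 tau = 0 -> 'D_('e_i) F z = 'D_('e_i) G z.
Proof.
move=> FG it zr zt; apply: derive_eq_line.
have c0 : {for (0 : R), continuous (fun h : R => h *: 'e_i + z)}.
  apply: cvgD; last exact: cvg_cst.
  by apply: (@cvgZr_tmp _ _ _ (nbhs (0 : R)) _ id); exact: cvg_id.
have H : \forall h \near (0 : R), cube r (h *: 'e_i + z).
  by apply: c0; rewrite scale0r add0r; exact: nbhs_cube.
apply: filterS H => h hr; apply: FG => //.
by rewrite !mxE /= zt eq_sym (negbTE it) mulr0 addr0.
Qed.

(** Each flow takes the previous one as initial data on a hyperplane. At 0 every partial derivative
    is read off at the stage introducing it, so the Jacobian there is [S p]; elsewhere only the last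
    row is known to follow its field. *)
Lemma three_flows : exists (r : R) (F : 'rV[R]_3 -> 'rV[R]_3),
  [/\ 0 < r, smooth_on (cube r) F, F 0 = p, forall z, cube r z -> U (F z) &
  [/\ forall z, cube r z -> Jac F z *m a (F z) = delta_mx 0 0,
      forall z, cube r z -> row ord_max (Jac F z) = row ord_max (S (F z)) &
      Jac F 0 = S p]].
Proof.
have cp : smooth_on (cube 1) (fun _ : 'rV[R]_3 => p) by move=> k; exact: Ck_cst.
have [r1 [y1 [r10 r11 cy1 Uy1 [dy1 y1p]]]] :=
  local_flow (0 : 'I_3) oU (cSrow 0) ltr01 cp Up.
have in0 r : 0 < r -> cube r (0 : 'rV[R]_3) by rewrite /cube /= normr0.
have z0 (i : 'I_3) : (0 : 'rV[R]_3) 0 i = 0 by rewrite mxE.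
have y10 : y1 0 = p by rewrite y1p//; exact: in0.
have Uy10 : U (y1 0) by rewrite y10.
have [r2 [y2 [r20 r21 cy2 Uy2 [dy2 y2y1]]]] :=
  local_flow (1 : 'I_3) oU (cSrow 1) r10 cy1 Uy10.
have y20 : y2 0 = p by rewrite y2y1//; exact: in0.
have Uy20 : U (y2 0) by rewrite y20.
have [r3 [y3 [r30 r32 cy3 Uy3 [dy3 y3y2]]]] :=
  local_flow (ord_max : 'I_3) oU (cSrow ord_max) r20 cy2 Uy20.
have y30 : y3 0 = p by rewrite y3y2//; exact: in0.
have abs0 r : 0 < r -> `|0 : R| < r by rewrite normr0.
have s0 (i : 'I_3) r (z : 'rV[R]_3) : 0 < r -> cube r z -> cube r (set_coord i z 0).
  by move=> r0 zr; apply: cube_set_coord; rewrite ?normr0.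
have D0y1 z : cube r1 z -> 'D_('e_0) y1 z = row 0 (S (y1 z)).
  by move=> zr; have /@derive_val := dy1 z zr.
have D1y2 z : cube r2 z -> 'D_('e_1) y2 z = row 1 (S (y2 z)).
  by move=> zr; have /@derive_val := dy2 z zr.
have D2y3 z : cube r3 z -> 'D_('e_ord_max) y3 z = row ord_max (S (y3 z)).
  by move=> zr; have /@derive_val := dy3 z zr.
have D0y2 z : cube r2 z -> z 0 1 = 0 -> 'D_('e_0) y2 z = 'D_('e_0) y1 z.
  by move=> zr z1; apply: (derive_on_hyperplane y2y1).
have Dy3 i z : i != ord_max -> cube r3 z -> z 0 ord_max = 0 -> 'D_('e_i) y3 z = 'D_('e_i) y2 z.
  by move=> i2 zr z2; apply: (derive_on_hyperplane y3y2).
have a0y2 z : cube r2 z -> 'D_('e_0) y2 z *m a (y2 z) = row 0 (delta_mx 0 0 : 'cV[R]_3).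
  move=> zr; have y2c w : cube r2 w -> 'D_('e_1) y2 w *m a (y2 w) = row 1 (delta_mx 0 0 : 'cV[R]_3).
    by move=> wr; rewrite D1y2// Srow//; exact: Uy2.
  rewrite (flow_pullback_const 'e_0 cy2 Uy2 y2c zr).
  have z'r := s0 1 _ _ r20 zr; have z'r1 := cube_le r21 z'r.
  have z'1 : set_coord 1 z 0 0 1 = 0 by rewrite set_coord_tau.
  by rewrite D0y2// y2y1// D0y1// Srow//; exact: Uy1.
have a2y3 z : cube r3 z -> 'D_('e_ord_max) y3 z *m a (y3 z) = row ord_max (delta_mx 0 0 : 'cV[R]_3).
  by move=> zr; rewrite D2y3// Srow//; exact: Uy3.
have ay3 i z : i != ord_max -> cube r3 z -> 'D_('e_i) y3 z *m a (y3 z) =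
    'D_('e_i) y2 (set_coord ord_max z 0) *m a (y2 (set_coord ord_max z 0)).
  move=> i2 zr; rewrite (flow_pullback_const 'e_i cy3 Uy3 a2y3 zr).
  have z'r := s0 ord_max _ _ r30 zr.
  have z'2 : set_coord ord_max z 0 0 ord_max = 0 by rewrite set_coord_tau.
  by rewrite Dy3// y3y2.
exists r3, y3; split=> //; split=> [z zr|z zr|].
- have z'r := cube_le r32 (s0 ord_max _ _ r30 zr).
  apply/row_matrixP => i; rewrite row_mul row_Jac; have [->|->|->] := ord3P i.
  + by rewrite ay3// a0y2.
  + by rewrite ay3// D1y2// Srow//; exact: Uy2.
  + exact: a2y3.
- by rewrite row_Jac D2y3.
apply/row_matrixP => i; rewrite row_Jac; have [->|->|->] := ord3P i.
- by rewrite Dy3// ?D0y2// ?D0y1// ?y10//; exact: in0.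
- by rewrite Dy3// ?D1y2// ?y20//; exact: in0.
- by rewrite D2y3// ?y30//; exact: in0.
Qed.

Lemma Jac_comp (F G : 'rV[R]_3 -> 'rV[R]_3) z :
  differentiable G z -> differentiable F (G z) ->
  Jac (F \o G) z = Jac G z *m Jac F (G z).
Proof.
move=> dG dF; apply/row_matrixP => i.
by rewrite row_mul !row_Jac (mul_Jac _ dF) (derive_comp_diff _ dG dF).
Qed.

Variable rho : 'rV[R]_3 -> R^o.
Hypotheses (crho : smooth_on U rho) (Srho : forall z, U z -> \det (S z) * rho z = 1).

(* Reparametrizing the last coordinate of [three_flows] along the flow of
   [kappa^-1 e_3] normalizes the volume without changing the other conditions. *)
Lemma adapted_chart : exists (r : R) (F : 'rV[R]_3 -> 'rV[R]_3),
  [/\ 0 < r, smooth_on (cube r) F, F 0 = p, forall z, cube r z -> U (F z) &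
  [/\ forall z, cube r z -> Jac F z *m a (F z) = delta_mx 0 0,
      forall z, cube r z -> exists2 c, c != 0 &
        row ord_max (Jac F z) = c *: row ord_max (S (F z)) &
      forall z, cube r z -> \det (Jac F z) * rho (F z) = 1]].
Proof.
have [r [F [r0 cF F0 FU [Fa FS JF0]]]] := three_flows.
have oQ := @open_cube R 3 r.
have in0 r' : 0 < r' -> cube r' (0 : 'rV[R]_3) by rewrite /cube /= normr0.
pose kappa z : R^o := \det (Jac F z) * rho (F z).
have ckappa : smooth_on (cube r) kappa.
  move=> k; apply: CkM => //.
    by apply: Ck_det => //; apply: Ck_Jac => //; exact: (cF k.+1).
  exact: (Ck_comp oQ FU (crho k) (cF k)).
(* It contains 0, where [Jac F 0 = S p] and [Srho] give [kappa 0 = 1]. *)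
pose D : set 'rV[R]_3 := [set z | cube r z /\ kappa z != 0].
have oD : open D.
  rewrite openE => z [zr kz]; apply: filterI; first exact: nbhs_cube.
  exact: (cvgr_neq0 _ (ckappa 0%N z zr) kz).
pose V (z : 'rV[R]_3) : 'rV[R]_3 := (kappa z)^-1 *: 'e_ord_max.
have cV : smooth_on D V.
  move=> k; apply/(Ck_mx _ _ oD) => i j; under eq_fun do rewrite mxE.
  apply: CkM => //; last exact: Ck_cst.
  apply: CkV => // [u []//|].
  by apply: Ck_subset (ckappa k) => u [].
have D0 : D 0.
  by split; [exact: in0|rewrite /kappa JF0 F0 Srho// oner_neq0].
have [r' [G [r'0 r'r cG DG [dG Gid]]]] :=
  local_flow (ord_max : 'I_3) oD cV r0 (fun k => Ck_id k _) D0.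
have oQ' := @open_cube R 3 r'.
have G0 : G 0 = 0 by rewrite Gid ?mxE//; exact: in0.
have inr z : cube r' z -> cube r (G z) by move=> /DG[].
have k0 z : cube r' z -> kappa (G z) != 0 by move=> /DG[].
(* The field points along the last axis, so the pairing of [G] with another coordinate covector has
   zero time derivative. *)
have Gi (i : 'I_3) z : i != ord_max -> cube r' z -> G z 0 i = z 0 i.
  move=> i2 zr.
  have H := @constant_line R 3 1 1 ord_max (fun z => G z *m (delta_mx i 0 : 'cV[R]_3)) r' z _ zr.
  have {}H : G z *m delta_mx i 0 = G (set_coord ord_max z 0) *m (delta_mx i 0 : 'cV[R]_3).
    apply: H => w wr; have := is_derive_mulmxr (delta_mx i 0 : 'cV[R]_3) (dG w wr).
    rewrite -scalemxAl mul_delta_mx_cond eq_sym (negbTE i2) scaler0.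
    exact.
  move: H; rewrite -!colE => /(congr1 (fun M : 'cV[R]_1 => M 0 0)); rewrite !mxE => ->.
  rewrite Gid ?set_coord_tau ?set_coordE ?(negbTE i2)//.
  by apply: cube_set_coord; rewrite ?normr0.
have JG z : cube r' z -> (forall i k : 'I_3, k != ord_max -> Jac G z i k = (i == k)%:R) /\
    row ord_max (Jac G z) = (kappa (G z))^-1 *: 'e_ord_max.
  move=> zr; split; last by rewrite row_Jac; have /@derive_val := dG z zr.
  move=> i k k2; rewrite mxE derive_mx; last first.
    by apply: diff_derivable; exact: (cG 1%N).1.
  rewrite mxE; transitivity ('D_('e_i) (fun z : 'rV[R]_3 => z 0 k) z).
    by apply: near_eq_derive; apply: filterS (nbhs_cube zr) => w wr; rewrite Gi.
  have di : derivable (id : 'rV[R]_3 -> 'rV[R]_3) z 'e_i by exact: derivable_id.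
  have := derive_mx di.
  by rewrite derive_id => /rowP /(_ k); rewrite !mxE eqxx eq_sym.
have JE z : cube r' z -> Jac (F \o G) z = Jac G z *m Jac F (G z).
  by move=> zr; apply: Jac_comp; [exact: (cG 1%N).1|apply: (cF 1%N).1; exact: inr].
exists r', (F \o G); split=> //.
- by move=> k; apply: (Ck_comp_mx oQ' oQ inr (cF k) (cG k)).
- by rewrite /= G0.
- by move=> z /inr /FU.
split=> z zr; have zr' := inr z zr; have [JG1 JG2] := JG z zr; rewrite JE//=.
- rewrite -mulmxA Fa// -colE; apply/colP => i; rewrite [LHS]mxE JG1// [RHS]mxE.
  by rewrite eqxx andbT.
- exists (kappa (G z))^-1; first by rewrite invr_eq0 k0.
  by rewrite row_mul JG2 -scalemxAl -rowE FS.
(* [Jac G z] is upper triangular with diagonal 1, 1 and the inverse of [kappa (G z)]; transposing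
   fits [det_trig]. *)
have -> : \det (Jac G z *m Jac F (G z)) = (kappa (G z))^-1 * \det (Jac F (G z)).
  rewrite det_mulmx; congr (_ * _); rewrite -det_tr det_trig.
    rewrite !big_ord_recl big_ord0 [X in X * _]mxE [X in _ * (X * _)]mxE [X in _ * (_ *
        (X * _))]mxE.
    have -> : lift ord0 ord0 = 1 :> 'I_3 by exact/val_inj.
    have -> : lift ord0 (lift ord0 ord0) = ord_max :> 'I_3 by exact/val_inj.
    rewrite (JG1 ord0 ord0)// (JG1 1 1)// !eqxx !mul1r mulr1.
    by move/rowP : JG2 => /(_ ord_max); rewrite [LHS]mxE [RHS]mxE [X in _ * X]mxE !eqxx mulr1.
  apply/is_trig_mxP => i j ij; rewrite [LHS]mxE.
  have [j2|j2] := eqVneq i ord_max.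
    by move: ij; rewrite j2 /= ltnNge -ltnS ltn_ord.
  by rewrite JG1// -val_eqE gtn_eqF.
by rewrite -mulrA mulVf//; exact: k0.
Qed.

End adapted_chart.

(** * Integrability of the structure and closedness of the form *)

Section G1B_integrability.
Context {R : realType} (B : body R).
Variables (omega : one_form B) (L : line_distribution B) (Omega : three_form B).
Hypotheses (omega_neq0 : without_zeros omega)
  (omega_L : forall (x : B) (v : 'rV[R]_3), v \in L x -> omega x v = 0)
  (Omega_vol : is_volume_form Omega).
Local Notation "'e_ i" := (delta_mx 0 i : 'rV[R]_3) (at level 8, i at level 2).
Local Notation P := (G1B_structure omega_neq0 omega_L Omega_vol).

(** Differentiating [psi] after [phi], the identity near the point, shows that the coordinate map
    recovers [z] from [z *m coord_frame c y]. An adapted frame makes [omega] read its first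
    entry. *)
Lemma coord_form_derive (c : local_coordinates B) y v :
  coord_dom c y -> P y (coord_frame c y) ->
  'D_v (fun z => in_chart (Defs.coord c) z 0 0 : R^o) (chart B y) = omega y v.
Proof.
move=> cy [Fu w1 [w2 w3] _ _].
pose psi := in_chart (Defs.coord c); pose phi := chart B \o coord_inv c.
have oO := @coord_dom_open _ _ c; have oC := @coord_cod_open _ _ c.
have Cu := coord_in cy.
have phiu : phi (Defs.coord c y) = chart B y by rewrite /phi /= coordK.
have dphi : differentiable phi (Defs.coord c y) := (@coord_inv_smooth _ _ c 1%N).1 _ Cu.
have dpsi : differentiable psi (chart B y).
  by apply: (@coord_smooth _ _ c 1%N).1; exists y.
have psiphi : \forall u \near Defs.coord c y, psi (phi u) = u.
  apply: filterS (open_nbhs_nbhs (conj oC Cu)) => u uC.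
  by rewrite /psi /phi /= in_chartE coord_invK.
have key z : 'D_(z *m coord_frame c y) psi (chart B y) = z.
  have dpsi' : differentiable psi (phi (Defs.coord c y)) by rewrite phiu.
  have zE : 'D_z phi (Defs.coord c y) = z *m coord_frame c y by rewrite deriveEjacobian.
  rewrite -zE -phiu -(derive_comp_diff z dphi dpsi').
  rewrite -[RHS](derive_id (Defs.coord c y) z); apply: near_eq_derive.
  by apply: filterS psiphi => u.
rewrite -[v](mulmxKV Fu); move: (v *m _) => z.
rewrite (frame_one_form w1 w2 w3) -{2}(key z).
by rewrite derive_mx ?mxE//; apply: diff_derivable.
Qed.

Lemma integrable_closed : integrable_structure P -> closed_form omega.
Proof.
move=> intP x u v; have [c cx cP] := intP x.
have oO := @coord_dom_open _ _ c.
pose f z : R^o := in_chart (Defs.coord c) z 0 0.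
have Ox : (chart B @` coord_dom c) (chart B x) by exists x.
have omegaE v' : \forall z \near chart B x,
    in_chart (fun y => omega y v' : R^o) z = 'D_v' f z.
  apply: filterS (open_nbhs_nbhs (conj oO Ox)) => _ [y cy <-].
  by rewrite in_chartE coord_form_derive//; exact: cP.
have cf : Ck_on 2 (chart B @` coord_dom c) f.
  by have /(Ck_mx _ _ oO) := @coord_smooth _ _ c 2%N; exact.
rewrite /ext_deriv (near_eq_derive _ (omegaE v)) (near_eq_derive _ (omegaE u)).
by apply/eqP; rewrite subr_eq0; apply/eqP; exact: schwarz oO Ox cf.
Qed.

Lemma closed_integrable : closed_form omega -> integrable_structure P.
Proof.
move=> domega p.
have [V [s [oV Vp ss sP]]] := G1B_frames_section omega_neq0 omega_L Omega_vol p.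
pose U := chart B @` V.
have oU : open U by [].
have Up : U (chart B p) by exists p.
(* The coefficient column of [omega] in the chart: [v *m a] is the value on [v]. *)
pose a z : 'cV[R]_3 := \col_i in_chart (fun y => omega y 'e_i : R^o) z.
have ca : smooth_on U a.
  move=> k; apply/(Ck_mx _ _ oU) => i j; under eq_fun do rewrite mxE.
  exact: form_smooth_restr.
have aE y v : v *m a (chart B y) = (omega y v)%:M.
  apply/matrixP => i j; rewrite (ord1 i) (ord1 j) !mxE eqxx mulr1n.
  rewrite {2}[v]row_sum_delta linear_sum; apply: eq_bigr => k _.
  by rewrite linearZ /= mxE in_chartE.
have a_closed x t u : U x -> u *m 'D_t a x = t *m 'D_u a x.
  move=> Ux; have da := (ca 1%N).1 x Ux.
  have key t' u' : (u' *m 'D_t' a x) 0 0 =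
      'D_t' (in_chart (fun y => omega y u' : R^o)) x.
    have dt := derivableP (diff_derivable (v := t') da).
    have /is_derive_mxP /(_ 0 0) := is_derive_mulmxl u' dt.
    move=> /@derive_val <-; apply: near_eq_derive.
    apply: filterS (open_nbhs_nbhs (conj oU Ux)) => _ [y Vy <-].
    by rewrite aE mxE eqxx in_chartE.
  apply/matrixP => i j; rewrite (ord1 i) (ord1 j) (key t u) (key u t).
  case: Ux => y Vy <-; apply/eqP; rewrite -subr_eq0.
  exact/eqP/domega.
pose S := in_chart s.
have Sa z : U z -> S z *m a z = delta_mx 0 0.
  case=> y Vy <-; rewrite /S in_chartE; have [_ w1 [w2 w3] _ _] := sP y Vy.
  apply/row_matrixP => i; rewrite row_mul aE; apply/matrixP => j k.
  rewrite (ord1 j) (ord1 k) !mxE eqxx mulr1n.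
  by have [->|->|->] := ord3P i; rewrite ?w1 ?w2 ?w3.
pose rho z : R^o := in_chart (fun y => Omega y 'e_0 'e_1 'e_ord_max : R^o) z.
have crho : smooth_on U rho.
  exact: (@body_smooth_subset _ _ setT V _ _ _ (three_form_smooth Omega _ _ _)).
have Srho z : U z -> \det (S z) * rho z = 1.
  case=> y Vy <-; rewrite /S /rho !in_chartE; have [_ _ _ _ <-] := sP y Vy.
  by rewrite three_form_det.
have [r [F [r0 cF F0 FU [Fa FL Frho]]]] := adapted_chart oU ca a_closed ss Up Sa crho Srho.
have in0 : cube r (0 : 'rV[R]_3) by rewrite /cube /= normr0.
have Funit z : cube r z -> Jac F z \in unitmx.
  move=> zr; rewrite unitmxE unitfE; apply/eqP => d0.
  by have := Frho z zr; rewrite d0 mul0r => /esym/eqP; rewrite oner_eq0.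
have [C [W [g [oC oW C0 Cr [CW WC cg]]]]] :=
  inverse_function (@open_cube R 3 r) in0 cF (Funit 0 in0).
(* A total inverse of the chart; off the range its value is the arbitrary point [p]. *)
have chi_ex z : exists y, range (chart B) z -> chart B y = z.
  by have [[y _ <-]|nz] := pselect (range (chart B) z); [exists y|exists p].
have [chi chiP] := choice chi_ex.
have chiK x : chi (chart B x) = x by apply: (@chart_inj _ B); apply: chiP; exists x.
have rangeF z : cube r z -> range (chart B) (F z).
  by move=> /FU[y _ <-]; exists y.
have chiF z : C z -> chart B (chi (F z)) = F z by move=> /Cr /rangeF /chiP.
pose dom : set B := [set x | W (chart B x)].
have domE : chart B @` dom = W.
  apply/seteqP; split=> [_ [x Wx <-]//|u Wu].
  have [Cg <-] := WC u Wu; have [y _ yE] := rangeF _ (Cr _ Cg).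
  by exists y => //; rewrite /dom /= yE; exact: (CW _ Cg).1.
have odom : open_in dom by rewrite /open_in domE.
pose co (x : B) := g (chart B x).
pose ci (z : 'rV[R]_3) := chi (F z).
have co_in x : dom x -> C (co x) by move=> /WC[].
have ci_in z : C z -> dom (ci z) by move=> Cz; rewrite /dom /= /ci chiF//; exact: (CW z Cz).1.
have coK x : dom x -> ci (co x) = x by move=> Wx; rewrite /ci /co (WC _ Wx).2 chiK.
have ciK z : C z -> co (ci z) = z by move=> Cz; rewrite /co /ci chiF// (CW z Cz).2.
have cco : body_smooth_on dom co.
  move=> k; rewrite domE; apply: (Ck_ext (f := g) oW); last exact: cg.
  by move=> u Wu; move: (Wu); rewrite -domE => -[x Wx <-]; rewrite in_chartE.
have cci : smooth_on C (chart B \o ci).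
  move=> k; apply: (Ck_ext (f := F) oC); first by move=> z Cz; rewrite /= /ci chiF.
  exact: Ck_subset (cF k).
exists (LocalCoordinates odom oC co_in ci_in coK ciK cco cci).
  by rewrite /= /dom /= -F0; exact: (CW 0 C0).1.
move=> x /= Wx; have Cx := co_in x Wx; have Cxr := Cr _ Cx.
have FE : F (co x) = chart B x by rewrite /co (WC _ Wx).2.
(* The inverse coordinates read in the chart agree with [F] on the open set [C], which determines
   derivatives at [co x]. *)
have -> : coord_frame (LocalCoordinates odom oC co_in ci_in coK ciK cco cci) x = Jac F (co x).
  rewrite /coord_frame /= -Jac_jacobian; last exact: (cci 1%N).1.
  apply/row_matrixP => i; rewrite !row_Jac; apply: near_eq_derive.
  by apply: filterS (open_nbhs_nbhs (conj oC Cx)) => z Cz; rewrite /= /ci chiF.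
have wE i : omega x (row i (Jac F (co x))) = (i == 0)%:R.
  have := congr1 (row i) (Fa _ Cxr); rewrite row_mul FE aE => /matrixP /(_ 0 0).
  by rewrite !mxE eqxx mulr1n andbT.
have [y Vy yE] := FU _ Cxr.
have yx : y = x by apply: (@chart_inj _ B); rewrite yE.
split.
- exact: Funit.
- by rewrite wE.
- by rewrite !wE.
- have [k k0 kE] := FL _ Cxr; have [_ _ _ sL _] := sP y Vy.
  rewrite kE -yE /S in_chartE -yx -sL.
  apply/eqP; rewrite eqEsubv -!memvE memvZ ?memv_line//=.
  by rewrite -{1}[row _ _](scalerK k0) memvZ// memv_line.
rewrite three_form_det; have := Frho _ Cxr; rewrite FE /rho in_chartE.
exact.
Qed.

End G1B_integrability.

Theorem proposition6p5 (R : realType) (B : body R) (omega : one_form B)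
    (L : line_distribution B) (Omega : three_form B)
    (omega_neq0 : without_zeros omega)
    (omega_L : forall (x : B) (v : 'rV[R]_3), v \in L x -> omega x v = 0)
    (Omega_vol : is_volume_form Omega) :
  integrable_structure (G1B_structure omega_neq0 omega_L Omega_vol) <->
  closed_form omega.
Proof. by split; [exact: integrable_closed|exact: closed_integrable]. Qed.
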